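(* Let $X \subset \mathbb{Z}^2$ be a digital disk. Let $S$ be a minimal bounding curve for $X$. Let $p_0$ be the vertex of an interior angle of $S$, formed by slanted edges $E_1$ and $E_2$ of $S$, of measure $90^{\circ}$ ($\pi/2$ radians). Let $A$ be any of: a freezing set for $(X,c_1)$, a cold set for $(X,c_1)$, a freezing set for $(X,c_2)$, or a cold set for $(X,c_2)$. Let $X$ be $90^{\circ}$-thick at $p_0$. Then $p_0 \in A$.
   Context: Adjacencies in $\mathbb{Z}^2$: distinct points $(x_1,x_2)$, $(y_1,y_2)$ are $c_2$-adjacent if $|x_i-y_i|\le 1$ for $i=1,2$; they are $c_1$-adjacent if moreover they differ in exactly one coordinate. For $\kappa\in\{c_1,c_2\}$ and $X\subset\mathbb{Z}^2$: a $\kappa$-path of length $k$ is a sequence $x_0,\dots,x_k$ with consecutive points equal or $\kappa$-adjacent; a set is $\kappa$-connected if any two of its points are joined by a $\kappa$-path in it; $d_\kappa(x,y)$ is the minimal length of a $\kappa$-path in $X$ from $x$ to $y$. $f:X\to X$ is in $C(X,\kappa)$ (is $\kappa$-continuous) if $\kappa$-adjacent points have equal or $\kappa$-adjacent images. $A\subset X$ is a freezing set for $(X,\kappa)$ if every $f\in C(X,\kappa)$ with $f|_A=\mathrm{id}_A$ equals $\mathrm{id}_X$. For $(X,\kappa)$ connected, $A\subset X$ is a cold set if every $f\in C(X,\kappa)$ with $f|_A=\mathrm{id}_A$ satisfies $d_\kappa(x,f(x))\le 1$ for all $x\in X$. A $c_2$-closed curve is a $c_2$-path $\{s_i\}_{i=0}^m$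 with $s_0=s_m$ and $s_i\ne s_j$ whenever $0<|i-j|<m$. If $S\subset\mathbb{Z}^2$ is a $c_2$-closed curve such that $\mathbb{Z}^2\setminus S$ has two $c_1$-components, one finite and the other infinite, the finite one is denoted $Int(S)$ and the infinite one $Ext(S)$; then $D=S\cup Int(S)$ is a digital disk, $S$ is a bounding curve of $D$, and $Int(D)$ denotes $Int(S)$ when $S$ is understood. A disk may have several bounding curves; $S$ is minimal if no bounding curve of $D$ has fewer points. A digital line segment is a ($c_1$- or $c_2$-)connected collinear set of more than one point of $\mathbb{Z}^2$; it is horizontal or vertical (axis-parallel) or has slope $\pm1$ (slanted). The edges (sides) of $S$ are the maximal digital line segments in $S$. If edges $E_1,E_2$ of $S$ satisfy $E_1\cap E_2=\{p\}$, the interior angle at the vertex $p$ is the angle formed by $E_1$, $E_2$ and $Int(S)$. $90^\circ$-thickness (slanted sides): if $p$ is the vertex of a $90^\circ$ interior angle $\theta$ of $S$ with slanted sides, $X$ is $90^\circ$-thick at $p$ if there exists $q\in Int(X)$, in the interior of $\theta$, that is $c_1$-adjacent to $p$.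
   Formalization: The interior angle is required to be one of the curve: S passes through p_0 from E_1 to E_2, its two neighbours of p_0 lying on these edges; if edges merely meet at p_0 as point sets the claim fails, e.g. for X={0,1}×{-2,…,2}∪{(2,0)}, p_0=(0,0). *)

(* Defs.v *)
From mathcomp Require Import all_boot all_order all_algebra.
From mathcomp Require Import all_classical.

Set Implicit Arguments.
Unset Strict Implicit.
Unset Printing Implicit Defensive.

Import Order.TTheory GRing.Theory Num.Theory.
Local Open Scope classical_set_scope.
Local Open Scope ring_scope.

Notation Z2 := (int * int)%type.

Inductive adjacency := c1 | c2.

Definition adj (k : adjacency) (x y : Z2) : bool :=
  [&& x != y, `|x.1 - y.1| <= 1, `|x.2 - y.2| <= 1 &
      if k is c1 then (x.1 != y.1) (+) (x.2 != y.2) else true].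

Definition adjeq (k : adjacency) (x y : Z2) : bool := (x == y) || adj k x y.

(* The points [x :: p] form a [k]-path of length [size p] in [A]. *)
Definition path_in (k : adjacency) (A : set Z2) (x : Z2) (p : seq Z2) (y : Z2) :=
  [/\ path (adjeq k) x p, last x p = y & forall z, z \in x :: p -> A z].

Definition joined_in (k : adjacency) (A : set Z2) (x y : Z2) :=
  exists p, path_in k A x p y.

Definition kconnected (k : adjacency) (A : set Z2) :=
  forall x y, A x -> A y -> joined_in k A x y.

Definition component (k : adjacency) (A : set Z2) (x : Z2) : set Z2 :=
  [set y | joined_in k A x y].

Definition is_distance (k : adjacency) (X : set Z2) (x y : Z2) (n : nat) :=
  (exists2 p, path_in k X x p y & size p = n) /\
  (forall p, path_in k X x p y -> (n <= size p)%N).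

(* Self-maps of [X] are represented by maps of the plane preserving [X]; only
   their values on [X] matter. *)
Definition kcontinuous (k : adjacency) (X : set Z2) (f : Z2 -> Z2) :=
  (forall x, X x -> X (f x)) /\
  (forall x y, X x -> X y -> adj k x y -> adjeq k (f x) (f y)).

Definition freezing_set (k : adjacency) (X A : set Z2) :=
  A `<=` X /\
  forall f, kcontinuous k X f -> (forall a, A a -> f a = a) ->
    forall x, X x -> f x = x.

Definition cold_set (k : adjacency) (X A : set Z2) :=
  [/\ kconnected k X, A `<=` X &
      forall f, kcontinuous k X f -> (forall a, A a -> f a = a) ->
        forall x, X x -> exists2 n, is_distance k X x (f x) n & (n <= 1)%N].

(* A closed curve s_0, ..., s_m = s_0 is given by the list of the pairwise
   distinct points s_0, ..., s_(m-1); its number of points is its size. *)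
Definition closed_curve (s : seq Z2) : Prop := ucycle (adjeq c2) s.

Definition separates (s : seq Z2) :=
  exists I E : set Z2, [/\ finite_set I, infinite_set E &
    forall C, (exists2 x, (~` [set` s]) x & C = component c1 (~` [set` s]) x)
              <-> C = I \/ C = E].

(* When [separates s] holds, this is the unique finite component. *)
Definition Int (s : seq Z2) : set Z2 :=
  [set x | (~` [set` s]) x /\ finite_set (component c1 (~` [set` s]) x)].

Definition bounding_curve (s : seq Z2) (X : set Z2) :=
  [/\ closed_curve s, separates s & X = [set` s] `|` Int s].

Definition digital_disk (X : set Z2) := exists s, bounding_curve s X.

Definition minimal_bounding_curve (s : seq Z2) (X : set Z2) :=
  bounding_curve s X /\
  forall s', bounding_curve s' X -> (size s <= size s')%N.

Definition collinear (A : set Z2) :=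
  exists a b c : int, (a, b) != (0, 0) /\
    forall z, A z -> a * z.1 + b * z.2 = c.

Definition digital_segment (A : set Z2) :=
  [/\ collinear A, kconnected c1 A \/ kconnected c2 A &
      exists x y, [/\ A x, A y & x <> y]].

Definition slanted (A : set Z2) :=
  digital_segment A /\
  forall x y, A x -> A y -> `|x.1 - y.1| = `|x.2 - y.2|.

Definition edge (s : seq Z2) (E : set Z2) :=
  [/\ digital_segment E, E `<=` [set` s] &
      forall F, digital_segment F -> F `<=` [set` s] -> E `<=` F -> F = E].

(* Edges are sets of points, so two of them can also meet at a point [p] through
   which [s] does not run from one to the other, because distant parts of [s]
   come next to each other.  An angle of [s] at [p] is required to be formed by
   the edges along which [s] reaches and leaves [p]. *)
Definition meet_at (s : seq Z2) (E1 E2 : set Z2) (p : Z2) :=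
  [/\ edge s E1, edge s E2, E1 `&` E2 = [set p] &
      E1 (prev s p) /\ E2 (next s p) \/ E1 (next s p) /\ E2 (prev s p)].

(* The Euclidean plane, over the rationals: all the polygons and sectors below
   have rational vertices, so no real coordinates are needed. *)
Notation Q2 := (rat^o * rat^o)%type.

Definition toQ2 (x : Z2) : Q2 := (x.1%:~R, x.2%:~R).

Definition segment (x y : Q2) : set Q2 :=
  [set x + t *: (y - x) | t in [set t : rat | 0 <= t <= 1]].

Definition polygon (s : seq Z2) : set Q2 :=
  [set w | exists2 x, x \in s & segment (toQ2 x) (toQ2 (next s x)) w].

(* [w] and [z] lie in the same region of the plane cut along [polygon s]. *)
Definition same_region (s : seq Z2) (w z : Q2) :=
  exists2 l : seq Q2,
    path (fun x y => `[< segment x y `&` polygon s = set0 >]) w l & last w l = z.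

Definition sector_point (s : seq Z2) (p : Z2) (a b : rat) : Q2 :=
  toQ2 p + a *: (toQ2 (prev s p) - toQ2 p) + b *: (toQ2 (next s p) - toQ2 p).

(* The open convex sector with apex [p] between the two sides of [s] at [p]. *)
Definition convex_sector (s : seq Z2) (p : Z2) : set Q2 :=
  [set w | exists a b : rat, [/\ 0 < a, 0 < b & w = sector_point s p a b]].

(* Near [p], the convex sector (and not the reflex one) is on the side of
   [Int s]. *)
Definition convex_at (s : seq Z2) (p : Z2) :=
  exists2 e : rat, 0 < e & forall a b : rat, 0 < a < e -> 0 < b < e ->
    exists2 z, Int s z & same_region s (sector_point s p a b) (toQ2 z).

Definition orthogonal_at (s : seq Z2) (p : Z2) :=
  let u := prev s p - p in let v := next s p - p in
  u.1 * v.1 + u.2 * v.2 = 0.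

(* The interior angle formed by [E1] and [E2] at [p] measures 90 degrees: its
   sides are orthogonal and it is the convex sector, of measure 90 rather than
   270 degrees. *)
Definition right_interior_angle (s : seq Z2) (E1 E2 : set Z2) (p : Z2) :=
  [/\ meet_at s E1 E2 p, orthogonal_at s p & convex_at s p].

(* 90-degree thickness at the vertex [p] of a 90-degree interior angle of [s]
   with slanted sides. *)
Definition slanted_right_thick (s : seq Z2) (p : Z2) :=
  exists q, [/\ Int s q, convex_sector s p (toQ2 q) & adj c1 p q].

(* Main.v *)
(* Let N be the interior point in the angle at p and a, b the neighbours of p on
   the curve.  The claim amounts to: the only points of X that are c_2-adjacent
   to p are a, b and N.  Granted this, moving p alone, to a for c_1 and to
   2 N - p for c_2, contradicts the freezing or cold property of a set that
   misses p.

   Let E and W be the points c_1-adjacent to p on the far sides of the steps pa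
   and pb.  Windings are taken modulo 2.  If E and W are not on the curve S, they
   are exterior, since the winding of S changes across pa and pb; and then no
   other neighbour y of p is on S, since the chord py would close an arc of S
   separating E from W.

   Suppose E is on S.  Uncrossing pairs of diagonal steps, we may assume that S
   does not cross itself.  A chord uv cuts S into arcs R and K.  If K closed by
   the chord encloses R, while R closed by the chord does not enclose K, and R
   has a point c_1-adjacent to Int(S), then S can be replaced by K closed by the
   chord, R becoming interior: the two end points of a diagonal step of R are
   joined through a corner of the step.  This fails only if the corner is u (or
   v); then the chord from u to that step cuts R in two, and either one of the
   parts, possibly after moving u elsewhere on S, gives a shorter R, or u lies at
   a corner of the curve that can be cut off too.  So S is not minimal.  Such a
   chord exists: either pE or aE, or else S has winding 0 around N and some other
   chord closes an arc around N, for otherwise the crossings with a ray from N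
   would derive from a potential on S, which is impossible because S separates N
   from infinity. *)

Require Import Defs.
From mathcomp Require Import all_boot all_order all_algebra.
From mathcomp Require Import all_classical.
From mathcomp Require Import zify ring lra.

Set Implicit Arguments.
Unset Strict Implicit.
Unset Printing Implicit Defensive.

Import Order.TTheory GRing.Theory Num.Theory.
Local Open Scope classical_set_scope.
Local Open Scope ring_scope.

(** * Crossings of edges and rays *)

Definition king (x y : Z2) : bool :=
  [&& x.1 <= y.1 + 1, y.1 <= x.1 + 1, x.2 <= y.2 + 1 & y.2 <= x.2 + 1].

Definition diag (x y : Z2) : bool := [&& king x y, x.1 != y.1 & x.2 != y.2].

Definition corner (x y : Z2) : Z2 := (x.1, y.2).

Definition is_edge (x y a b : Z2) : bool :=
  (a == x) && (b == y) || (a == y) && (b == x).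

(* Counts the edges meeting the ray from a point slightly above and to the right
   of [z] in direction (1, 0); this makes sense even when [z] is an end point. *)
Definition cross (z a b : Z2) : bool :=
  [&& a.2 == z.2, b.2 == z.2 + 1 & z.1 < a.1]
  || [&& b.2 == z.2, a.2 == z.2 + 1 & z.1 < b.1].

Lemma kingE (x y : Z2) : king x y -> [/\ x.1 <= y.1 + 1, y.1 <= x.1 + 1,
  x.2 <= y.2 + 1 & y.2 <= x.2 + 1].
Proof. by case/and4P. Qed.

Lemma neq_Z2 (x y : Z2) : x != y -> x.1 <> y.1 \/ x.2 <> y.2.
Proof.
by case: x y => [x1 x2] [y1 y2]; rewrite xpair_eqE => /nandP[]/eqP; [left|right].
Qed.

Lemma eqE_Z2 (x y : Z2) : (x == y) = (x.1 == y.1) && (x.2 == y.2).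
Proof. by case: x y => [x1 x2] [y1 y2]. Qed.

Lemma Z2_eq (x y : Z2) : x.1 = y.1 -> x.2 = y.2 -> x = y.
Proof. by case: x y => [x1 x2] [y1 y2] /= -> ->. Qed.

Ltac atoms :=
  repeat (first [case: eqP => ? | case: ltP => ? | case: leP => ?];
          try (exfalso; lia)) => //=.

Lemma king_sym : symmetric king.
Proof. by move=> x y; apply/and4P/and4P => -[]; split. Qed.

Lemma diag_sym : symmetric diag.
Proof. by move=> x y; rewrite /diag king_sym eq_sym [y.2 == _]eq_sym. Qed.

Lemma diag_king x y : diag x y -> king x y.
Proof. by case/and3P. Qed.

Lemma king_adjeq x y : adjeq c2 x y = king x y.
Proof.
rewrite /adjeq /adj /king; case: eqVneq => [->|/neq_Z2 n] /=; first by lia.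
by lia.
Qed.

Lemma adj1E (x y : Z2) : adj c1 x y ->
  x.1 = y.1 /\ (x.2 = y.2 + 1 \/ y.2 = x.2 + 1)
  \/ x.2 = y.2 /\ (x.1 = y.1 + 1 \/ y.1 = x.1 + 1).
Proof.
case/and4P=> /neq_Z2 n h1 h2; case: eqP => h3; case: eqP => h4 //= _; lia.
Qed.

Lemma adj1I (x y : Z2) :
  x.1 = y.1 /\ (x.2 = y.2 + 1 \/ y.2 = x.2 + 1)
  \/ x.2 = y.2 /\ (x.1 = y.1 + 1 \/ y.1 = x.1 + 1) -> adj c1 x y.
Proof.
move=> h; have h1 : `|x.1 - y.1| <= 1 by lia.
have h2 : `|x.2 - y.2| <= 1 by lia.
by rewrite /adj eqE_Z2 h1 h2; do 2![case: eqP => ?] => //=; lia.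
Qed.

Lemma adj1_sym : symmetric (adj c1).
Proof. by move=> x y; apply/idP/idP => /adj1E h; apply: adj1I; lia. Qed.

Lemma adj1_king x y : adj c1 x y -> king x y.
Proof. by move=> /adj1E h; apply/and4P; split; lia. Qed.

Lemma king_cases (x y : Z2) : king x y -> [\/ x = y, adj c1 x y | diag x y].
Proof.
move=> k; case: (boolP (diag x y)) => [|nd]; first by constructor 3.
case: (eqVneq x y) => [->|/neq_Z2 n]; first by constructor 1.
constructor 2; apply: adj1I; move: nd; rewrite /diag k /=.
case/kingE: k => ? ? ? ?; case: eqP => ?; case: eqP => ? //= _; lia.
Qed.

Lemma is_edgeC x y a b : is_edge x y a b = is_edge x y b a.
Proof. by rewrite /is_edge orbC; congr orb; apply: andbC. Qed.

Lemma is_edge_sym x y a b : is_edge x y a b = is_edge y x a b.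
Proof. by rewrite /is_edge orbC. Qed.

Lemma crossC z a b : cross z a b = cross z b a.
Proof. by rewrite /cross orbC. Qed.

Lemma cross_right (z a b : Z2) : (z.1 + 1, z.2) != a -> (z.1 + 1, z.2) != b ->
  cross z a b = cross (z.1 + 1, z.2) a b.
Proof. by rewrite /cross => /neq_Z2/= n1 /neq_Z2/= n2; atoms. Qed.

(** The two rays bound a strip whose lattice points are those of row [z.2 + 1] to the right of [z].
    Edges avoiding [z] and the point above it cannot pass the left end of the strip, so the
    difference is a coboundary and cancels on closed walks. *)
Lemma cross_up (z a b : Z2) : king a b ->
    (z.1, z.2 + 1) != a -> (z.1, z.2 + 1) != b -> z != a -> z != b ->
  cross z a b (+) cross (z.1, z.2 + 1) a b =
  ((a.2 == z.2 + 1) && (z.1 < a.1)) (+) ((b.2 == z.2 + 1) && (z.1 < b.1)).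
Proof.
move=> /kingE[k1 k2 k3 k4] /neq_Z2/= n1 /neq_Z2/= n2 /neq_Z2 n3 /neq_Z2 n4.
by rewrite /cross /=; atoms.
Qed.

(** As in [cross_up], but the left end of the strip now follows the diagonal from [u] to [v]. Of the
    edges avoiding [u] and [v], only the other diagonal of that unit square passes it. *)
Lemma cross_diag (u v a b : Z2) : king a b -> v.2 = u.2 + 1 ->
    v.1 = u.1 + 1 \/ u.1 = v.1 + 1 ->
    u != a -> u != b -> v != a -> v != b ->
  cross u a b (+) cross v a b = is_edge (corner u v) (corner v u) a b
    (+) (((a.2 == v.2) && (v.1 < a.1)) (+) ((b.2 == v.2) && (v.1 < b.1))).
Proof.
move=> /kingE[k1 k2 k3 k4] e1 e2 /neq_Z2 n1 /neq_Z2 n2 /neq_Z2 n3 /neq_Z2 n4.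
by rewrite /cross /is_edge !eqE_Z2 /=; atoms.
Qed.

Lemma cross_triangle (z a b c : Z2) : king a b -> king b c -> king a c ->
  z != a -> z != b -> z != c -> cross z a b (+) (cross z b c (+) cross z c a) = false.
Proof.
move=> /kingE[k1 k2 k3 k4] /kingE[k5 k6 k7 k8] /kingE[k9 k10 k11 k12].
move=> /neq_Z2 n1 /neq_Z2 n2 /neq_Z2 n3.
by rewrite /cross; atoms.
Qed.

(* The eight neighbours of [u], numbered counterclockwise from [u + (1, 0)]. *)
Definition ring_pt (u : Z2) (k : nat) : Z2 :=
  (u.1 + nth 0 [:: 1; 1; 0; -1; -1; -1; 0; 1] k,
   u.2 + nth 0 [:: 0; 1; 1; 1; 0; -1; -1; -1] k).

(** The ray at [u] starts just after direction 0. Turning its start counterclockwise to direction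
    [k] sweeps over the directions strictly between 0 and [k]. *)
Definition arc (u : Z2) (k : nat) (b : Z2) : bool :=
  has (fun j => b == ring_pt u j) (iota 1 k.-1).

Definition spoke (u : Z2) (k : nat) (a b : Z2) : bool :=
  (a == u) && arc u k b || (b == u) && arc u k a.

(** Indicator of the lattice points in the strip between the rays of [u] and of [ring_pt u k], as in
    [cross_up]. *)
Definition ring_pot (u : Z2) (k : nat) (q : Z2) : bool :=
  match k with
  | 1%N => (q.2 == u.2 + 1) && (u.1 + 1 < q.1)
  | 2%N => (q.2 == u.2 + 1) && (u.1 < q.1)
  | 3%N => (q.2 == u.2 + 1) && (u.1 - 1 < q.1)
  | 5%N | 6%N | 7%N => (q.2 == u.2) && (u.1 <= q.1)
  | _ => false
  end.

(** Unlike in [cross_up], [u] may be an end of the edge: moving the start of the ray from beside [u]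
    to a neighbour adds the spokes swept on the way. *)
Lemma cross_ring (u : Z2) (k : nat) (a b : Z2) : (k < 8)%N -> king a b ->
    ring_pt u k != a -> ring_pt u k != b ->
    (odd k ->
       ~~ is_edge (corner u (ring_pt u k)) (corner (ring_pt u k) u) a b) ->
  cross u a b (+) cross (ring_pt u k) a b =
  spoke u k a b (+) (ring_pot u k a (+) ring_pot u k b).
Proof.
move=> k8 /kingE[k1 k2 k3 k4] /neq_Z2 n1 /neq_Z2 n2.
rewrite /cross /spoke /arc /ring_pot /is_edge.
case: k k8 n1 n2 => [|[|[|[|[|[|[|[|k]]]]]]]] //= _; rewrite /ring_pt /= => n1 n2 h;
  rewrite !eqE_Z2 /= ?andbF ?orbF ?addrA ?addr0 in n1 n2 h *.
- by atoms.
- by move: {h} (h isT) => /=; atoms.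
- by clear h; atoms.
- by move: {h} (h isT) => /=; atoms.
- by clear h; atoms.
- by move: {h} (h isT) => /=; atoms.
- by clear h; atoms.
- by move: {h} (h isT) => /=; atoms.
Qed.

(** * Windings of closed walks *)

Lemma cycle_true (T : Type) (c : seq T) : cycle (fun _ _ => true) c.
Proof.
have H : forall (p : seq T) x, path (fun _ _ => true) x p by elim=> //= y p IH _.
by case: c => [|x p] //=; apply: H.
Qed.

Section ClosedSums.
Variable T : eqType.
Implicit Types (f h : T -> T -> bool) (x y : T) (p q c : seq T).

Fixpoint psum f x p : bool :=
  if p is y :: p' then f x y (+) psum f y p' else false.

Definition csum f c : bool := if c is x :: p then psum f x (rcons p x) else false.

Lemma psum_cat f x p q : psum f x (p ++ q) = psum f x p (+) psum f (last x p) q.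
Proof. by elim: p x => //= y p IH x; rewrite IH addbA. Qed.

Lemma psum_rcons f x p y : psum f x (rcons p y) = psum f x p (+) f (last x p) y.
Proof. by rewrite -cats1 psum_cat /= addbF. Qed.

Lemma csum_cons f x p : csum f (x :: p) = psum f x p (+) f (last x p) x.
Proof. exact: psum_rcons. Qed.

Lemma psum_rev f x p : (forall a b, f a b = f b a) ->
  psum f (last x p) (rev (belast x p)) = psum f x p.
Proof.
move=> fC; elim: p x => //= y p IH x.
rewrite rev_cons psum_rcons IH fC addbC; congr (_ (+) _).
by case: p {IH} => [|z p] //=; rewrite rev_cons last_rcons.
Qed.

Lemma csum_rot f p q : csum f (p ++ q) = csum f (q ++ p).
Proof.
case: p q => [|x p] [|y q]; rewrite ?cats0 //= !rcons_cat !psum_cat /=.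
by rewrite !psum_rcons !addbA -[LHS]addbA [LHS]addbC !addbA.
Qed.

Lemma csum_rev f c : (forall a b, f a b = f b a) -> csum f (rev c) = csum f c.
Proof.
move=> fC; case/lastP: c => [|p y] //; rewrite rev_rcons.
have -> : csum f (rcons p y) = csum f (y :: p) by rewrite -cats1 csum_rot.
by rewrite /= -(psum_rev y (rcons p y) fC) last_rcons belast_rcons rev_cons.
Qed.

Lemma psum_eq0 f x p : path (fun a b => ~~ f a b) x p -> psum f x p = false.
Proof. by elim: p x => //= y p IH x /andP[/negbTE-> /IH->]. Qed.

Lemma csum_eq0 f c : cycle (fun a b => ~~ f a b) c -> csum f c = false.
Proof. by case: c => [|x p] //=; apply: psum_eq0. Qed.

Lemma psum_cob e f h (g : T -> bool) x p : path e x p ->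
    {in x :: p &, forall a b, e a b -> f a b = h a b (+) (g a (+) g b)} ->
  psum f x p = psum h x p (+) (g x (+) g (last x p)).
Proof.
elim: p x => [|y p IH] x /=; first by rewrite addbb.
move=> /andP[exy ep] H; rewrite (H x y) ?inE ?eqxx ?orbT // (IH y) //.
  by case: (h x y); case: (psum h y p); case: (g x); case: (g y); case: (g _).
by move=> a b ha hb; apply: H; rewrite in_cons ?ha ?hb orbT.
Qed.

Lemma csum_cob e f h (g : T -> bool) c : cycle e c ->
    {in c &, forall a b, e a b -> f a b = h a b (+) (g a (+) g b)} ->
  csum f c = csum h c.
Proof.
case: c => [|x p] //= ec H; rewrite (psum_cob ec (h := h) (g := g)).
  by rewrite last_rcons addbb addbF.
by move=> a b; rewrite !inE !mem_rcons !inE !orbA !orbb => ha hb; apply: H;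
   rewrite inE.
Qed.

Lemma psum_add f h x p :
  psum (fun a b => f a b (+) h a b) x p = psum f x p (+) psum h x p.
Proof. by elim: p x => //= y p IH x; rewrite IH addbACA. Qed.

Lemma csum_add f h c :
  csum (fun a b => f a b (+) h a b) c = csum f c (+) csum h c.
Proof. by case: c => //= x p; apply: psum_add. Qed.

End ClosedSums.

Definition winding (z : Z2) (c : seq Z2) : bool := csum (cross z) c.

(** Steps being king moves, two of them can cross away from lattice points only as the two diagonals
    of one unit square. *)
Definition uncrossed (x y a b : Z2) : bool := ~~ is_edge (corner x y) (corner y x) a b.

Lemma uncrossedC x y a b : uncrossed x y a b = uncrossed x y b a.
Proof. by rewrite /uncrossed is_edgeC. Qed.

Lemma uncrossed_sym x y a b : uncrossed x y a b = uncrossed y x a b.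
Proof. by rewrite /uncrossed is_edge_sym. Qed.

Lemma winding_rev z c : winding z (rev c) = winding z c.
Proof. by apply: csum_rev => a b; apply: crossC. Qed.

Lemma winding_rot z p q : winding z (p ++ q) = winding z (q ++ p).
Proof. exact: csum_rot. Qed.

Lemma mem_neq (T : eqType) (z a : T) (c : seq T) : z \notin c -> a \in c -> z != a.
Proof. by move=> zc ac; apply: contraNneq zc => ->. Qed.

Lemma winding_adj1 z z' c : cycle king c -> adj c1 z z' ->
  z \notin c -> z' \notin c -> winding z c = winding z' c.
Proof.
have right z0 : cycle king c -> z0 \notin c -> (z0.1 + 1, z0.2) \notin c ->
    winding z0 c = winding (z0.1 + 1, z0.2) c.
  move=> kc n1 n2; apply: (csum_cob (e := king) (g := xpred0) kc) => a b ha hb k.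
  by rewrite /= addbF; apply: cross_right; apply: mem_neq n2 _.
have up z0 : cycle king c -> z0 \notin c -> (z0.1, z0.2 + 1) \notin c ->
    winding z0 c = winding (z0.1, z0.2 + 1) c.
  move=> kc n1 n2; apply: (csum_cob (e := king) kc
    (g := fun q => (q.2 == z0.2 + 1) && (z0.1 < q.1))) => a b ha hb k.
  rewrite -cross_up ?(mem_neq n1) ?(mem_neq n2) //.
  by rewrite [RHS]addbC -addbA addbb addbF.
move=> kc /adj1E a n n'.
have [e1|[e1|[e1|e1]]] : z' = (z.1 + 1, z.2) \/ z = (z'.1 + 1, z'.2) \/
    z' = (z.1, z.2 + 1) \/ z = (z'.1, z'.2 + 1).
- case: z z' a {n n'} => [x y] [x' y'] /= a.
  case: a => -[e [e'|e']]; subst; [do 3!right|do 2!right; left|right; left|left]; done.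
- by rewrite e1; apply: right => //; rewrite -e1.
- by rewrite e1; apply/esym; apply: right => //; rewrite -e1.
- by rewrite e1; apply: up => //; rewrite -e1.
- by rewrite e1; apply/esym; apply: up => //; rewrite -e1.
Qed.

(** The two points face each other across the diagonal from [x] to [y], so passing from one to the
    other crosses the walk once for each traversal of that diagonal. *)
Lemma winding_diag x y c : cycle king c -> diag x y ->
    corner x y \notin c -> corner y x \notin c ->
  winding (corner x y) c (+) winding (corner y x) c = csum (is_edge x y) c.
Proof.
move=> kc; wlog h : x y / x.2 = y.2 + 1.
  move=> H dxy n n'; have [h|h] : x.2 = y.2 + 1 \/ y.2 = x.2 + 1.
  - by case/and3P: dxy => /kingE[_ _ h1 h2] _ /eqP; lia.
  - exact: H.
  - rewrite addbC H // 1?diag_sym //.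
    by apply: (csum_cob (e := king) (g := xpred0) kc) => a b _ _ _;
       rewrite /= addbF is_edge_sym.
move=> dxy n n'; rewrite -csum_add.
apply: (csum_cob (e := king) kc (g := fun q => (q.2 == x.2) && (y.1 < q.1))).
move=> a b ha hb kab.
rewrite (@cross_diag (corner x y) (corner y x)) ?(mem_neq n) ?(mem_neq n') //=.
by case/and3P: dxy => /kingE[h1 h2 _ _] /eqP; lia.
Qed.

Lemma winding_king x y c : cycle king c -> king x y -> x \notin c -> y \notin c ->
  (diag x y -> cycle (uncrossed x y) c) -> winding x c = winding y c.
Proof.
move=> kc kxy nx ny h; case/king_cases: kxy => [->//|a|d]; first exact: winding_adj1.
suff: winding x c (+) winding y c = false by case: winding; case: winding.
have ex : corner (corner x y) (corner y x) = x by case: (x).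
have ey : corner (corner y x) (corner x y) = y by case: (y).
rewrite -{1}ex -{1}ey winding_diag ?ex ?ey //; first exact: csum_eq0 (h d).
by move: d; rewrite /diag /king /= => /and3P[/and4P[-> -> -> ->] -> h']; rewrite eq_sym.
Qed.

Lemma winding_path x p c : cycle king c ->
    path (fun a b => king a b && (diag a b ==> cycle (uncrossed a b) c)) x p ->
    {in x :: p, forall a, a \notin c} ->
  {in x :: p, forall a, winding a c = winding x c}.
Proof.
move=> kc; elim: p x => [|y p IH] x /=; first by move=> _ _ a; rewrite inE => /eqP->.
move=> /andP[/andP[kxy /implyP h] hp] nc a; rewrite inE => /orP[/eqP->//|ha].
rewrite (IH y) //; last by move=> b hb; apply: nc; rewrite inE hb orbT.
by apply/esym/winding_king => //; apply: nc; rewrite !inE eqxx ?orbT.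
Qed.

Lemma winding_triangle z a b c : king a b -> king b c -> king a c ->
  z \notin [:: a; b; c] -> winding z [:: a; b; c] = false.
Proof.
move=> k1 k2 k3; rewrite !inE !negb_or => /and3P[n1 n2 n3].
by rewrite /winding /= addbF addbA -addbA cross_triangle.
Qed.

Lemma winding_ring u k c : cycle king c -> (k < 8)%N -> ring_pt u k \notin c ->
    (odd k -> cycle (uncrossed u (ring_pt u k)) c) ->
  winding u c (+) winding (ring_pt u k) c = csum (spoke u k) c.
Proof.
move=> kc k8 n h.
pose e a b := king a b && (odd k ==> uncrossed u (ring_pt u k) a b).
rewrite -csum_add; apply: (csum_cob (e := e) (g := ring_pot u k)).
  rewrite (cycle_relI king (fun a b => odd k ==> uncrossed u (ring_pt u k) a b)).
  rewrite kc /=; case: (odd k) h => [h|_]; first exact: h isT.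
  exact: cycle_true.
move=> a b ha hb /andP[kab /implyP hk].
by apply: cross_ring => //; apply: mem_neq n _.
Qed.

Lemma winding_top (z : Z2) (c : seq Z2) : {in c, forall a : Z2, a.2 <= z.2} -> winding z c = false.
Proof.
move=> h; transitivity (csum (fun _ _ : Z2 => false) c); last first.
  by apply: csum_eq0; apply: cycle_true.
have kc : cycle (fun _ _ : Z2 => true) c.
  exact: cycle_true.
apply: (csum_cob kc (g := xpred0)) => a b /h ha /h hb _.
by rewrite /cross; atoms.
Qed.

Lemma winding_right (z : Z2) (c : seq Z2) : {in c, forall a : Z2, a.1 <= z.1} -> winding z c = false.
Proof.
move=> h; transitivity (csum (fun _ _ : Z2 => false) c); last first.
  by apply: csum_eq0; apply: cycle_true.
have kc : cycle (fun _ _ : Z2 => true) c.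
  exact: cycle_true.
apply: (csum_cob kc (g := xpred0)) => a b /h ha /h hb _.
by rewrite /cross; atoms.
Qed.

Lemma winding_bottom (z : Z2) (c : seq Z2) : cycle king c -> z \notin c ->
  {in c, forall a : Z2, z.2 <= a.2} -> winding z c = false.
Proof.
move=> kc n h; transitivity (csum (fun _ _ : Z2 => false) c); last first.
  by apply: csum_eq0; apply: cycle_true.
apply: (csum_cob kc (g := fun q => (q.2 == z.2) && (z.1 < q.1))) => a b ha hb.
move=> /kingE[k1 k2 k3 k4]; have := mem_neq n ha; have := mem_neq n hb.
move=> /neq_Z2 n1 /neq_Z2 n2; have h1 := h _ ha; have h2 := h _ hb.
by rewrite /cross; atoms.
Qed.

Lemma winding_left (z : Z2) (c : seq Z2) : cycle king c -> z \notin c ->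
  {in c, forall a : Z2, z.1 <= a.1} -> winding z c = false.
Proof.
move=> kc n h; transitivity (csum (fun _ _ : Z2 => false) c); last first.
  by apply: csum_eq0; apply: cycle_true.
apply: (csum_cob kc (g := fun q => q.2 <= z.2)) => a b ha hb.
move=> /kingE[k1 k2 k3 k4]; have := mem_neq n ha; have := mem_neq n hb.
move=> /neq_Z2 n1 /neq_Z2 n2; have h1 := h _ ha; have h2 := h _ hb.
by rewrite /cross; atoms.
Qed.

(** * The two sides of a curve *)

Lemma adj1_neq x y : adj c1 x y -> x != y.
Proof. by case/and4P. Qed.

Section Joined.
Variable A : set Z2.

Lemma joined_refl x : A x -> joined_in c1 A x x.
Proof. by move=> Ax; exists [::]; split=> // z; rewrite inE => /eqP->. Qed.

Lemma joined_adj x y : A x -> A y -> adj c1 x y -> joined_in c1 A x y.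
Proof.
move=> Ax Ay a; exists [:: y]; split=> //=; first by rewrite /adjeq a orbT.
by move=> z; rewrite !inE => /orP[]/eqP->.
Qed.

Lemma joined_trans x y z :
  joined_in c1 A x y -> joined_in c1 A y z -> joined_in c1 A x z.
Proof.
case=> p [pp lp Ap] [q [pq lq Aq]]; exists (p ++ q).
split; first by rewrite cat_path pp lp.
  by rewrite last_cat lp.
move=> t; rewrite inE mem_cat orbA => /orP[h|h]; first by apply: Ap; rewrite inE.
by apply: Aq; rewrite inE h orbT.
Qed.

Lemma joined_sym x y : joined_in c1 A x y -> joined_in c1 A y x.
Proof.
case=> p [pp lp Ap]; exists (rev (belast x p)); split.
- rewrite -lp rev_path; apply: sub_path pp => a b; rewrite /adjeq adj1_sym.
  by rewrite eq_sym.
- by case: p {pp Ap} lp => [|z p] //= _; rewrite rev_cons last_rcons.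
- move=> z; rewrite -lp inE mem_rev => h; apply: Ap.
  by rewrite lastI mem_rcons inE.
Qed.

Lemma joined_ind (P : Z2 -> Prop) :
    (forall x y, A x -> A y -> adj c1 x y -> P x -> P y) ->
  forall x y, joined_in c1 A x y -> P x -> P y.
Proof.
move=> step x y [p []]; elim: p x => [|z p IH] x /=; first by move=> _ -> _.
move=> /andP[/orP[/eqP<-|a] pp] lp Ap Px.
  by apply: IH pp lp _ Px => t h; apply: Ap; rewrite inE h orbT.
apply: (IH z) => //; first by move=> t h; apply: Ap; rewrite inE h orbT.
by apply: step Px => //; apply: Ap; rewrite !inE eqxx ?orbT.
Qed.

End Joined.

Lemma joined_sub (A B : set Z2) x y : A `<=` B -> joined_in c1 A x y -> joined_in c1 B x y.
Proof. by move=> AB [p [pp lp Ap]]; exists p; split=> // z /Ap/AB. Qed.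

Lemma joined_left (A : set Z2) x y : joined_in c1 A x y -> A x.
Proof. by case=> p [_ _ Ap]; apply: Ap; rewrite inE eqxx. Qed.

(** The finite and the infinite component of the complement of [S], described by joinedness rather
    than through the set of all components, so that the description can be checked directly for a
    new curve. *)
Definition sides (S : seq Z2) (I O : set Z2) : Prop :=
  [/\ finite_set I /\ infinite_set O, I !=set0 /\ I `&` O = set0,
      forall z, z \notin S <-> I z \/ O z,
      (forall x y, I x -> I y -> joined_in c1 (~` [set` S]) x y) /\
      (forall x y, O x -> O y -> joined_in c1 (~` [set` S]) x y) &
      forall x y, I x -> O y -> ~~ adj c1 x y].

Lemma notin_setC (S : seq Z2) z : z \notin S -> (~` [set` S]) z.
Proof. by move=> /negP. Qed.

Lemma separates_sides s : separates s -> exists O, sides s (Int s) O.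
Proof.
case=> I [O [finI infO H]].
have compE x y : joined_in c1 (~` [set` s]) x y ->
    component c1 (~` [set` s]) x = component c1 (~` [set` s]) y.
  move=> j; apply/seteqP; split=> z /= jz; last exact: joined_trans j jz.
  exact: joined_trans (joined_sym j) jz.
have [x0 nx0 eI] : exists2 x, (~` [set` s]) x & I = component c1 (~` [set` s]) x.
  by apply/H; left.
have [x1 nx1 eO] : exists2 x, (~` [set` s]) x & O = component c1 (~` [set` s]) x.
  by apply/H; right.
have IE z : I z -> (~` [set` s]) z /\ component c1 (~` [set` s]) z = I.
  rewrite {1}eI => j; split; first exact: joined_left (joined_sym j).
  by rewrite -(compE _ _ j).
have OE z : O z -> (~` [set` s]) z /\ component c1 (~` [set` s]) z = O.
  rewrite {1}eO => j; split; first exact: joined_left (joined_sym j).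
  by rewrite -(compE _ _ j).
have nIO : I <> O by move=> e; apply: infO; rewrite -e.
have eInt : Int s = I.
  apply/seteqP; split=> z; last by move=> Iz; have [nz e] := IE _ Iz; split; rewrite ?e.
  case=> nz fin.
  have [e|e] : component c1 (~` [set` s]) z = I \/ component c1 (~` [set` s]) z = O.
  - by apply/H; exists z.
  - by rewrite -e; apply: joined_refl.
  - by case: infO; rewrite -e.
exists O; rewrite eInt; split=> //.
- split; first by exists x0; rewrite eI; apply: joined_refl.
  apply/seteqP; split=> // z [/IE[_ e1] /OE[_ e2]].
  by apply: nIO; rewrite -e1.
- move=> z; split=> [/notin_setC nz|].
    have [e|e] : component c1 (~` [set` s]) z = I \/ component c1 (~` [set` s]) z = O.
    + by apply/H; exists z.
    + by left; rewrite -e; apply: joined_refl.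
    + by right; rewrite -e; apply: joined_refl.
  by case=> [/IE[]|/OE[]] /negP.
- split=> x y.
    by move=> /IE[_ e]; rewrite -e.
  by move=> /OE[_ e]; rewrite -e.
- move=> x y /IE[nx ex] /OE[ny ey]; apply/negP => a; apply: nIO.
  by rewrite -ex -ey; apply: compE; apply: joined_adj.
Qed.

Lemma sides_separates Z I O : sides Z I O -> separates Z /\ Int Z = I.
Proof.
case=> -[finI infO] [[x0 Ix0] dis] cov [jI jO] na.
have step x y : (~` [set` Z]) x -> (~` [set` Z]) y -> adj c1 x y -> I x -> I y.
  move=> _ /negP/cov[//|Oy] a Ix; by have := na _ _ Ix Oy; rewrite a.
have stepO x y : (~` [set` Z]) x -> (~` [set` Z]) y -> adj c1 x y -> O x -> O y.
  by move=> _ /negP/cov[Iy|//] a Ox; have := na _ _ Iy Ox; rewrite adj1_sym a.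
have compI x : I x -> component c1 (~` [set` Z]) x = I.
  move=> Ix; apply/seteqP; split=> y; last exact: jI.
  by move=> /(joined_ind step); apply.
have compO x : O x -> component c1 (~` [set` Z]) x = O.
  move=> Ox; apply/seteqP; split=> y; last exact: jO.
  by move=> /(joined_ind stepO); apply.
have [x1 Ox1] : O !=set0.
  by apply/set0P/negP => /eqP O0; apply: infO; rewrite O0.
have I_notin z : I z -> (~` [set` Z]) z by move=> Iz; apply/negP/cov; left.
have O_notin z : O z -> (~` [set` Z]) z by move=> Oz; apply/negP/cov; right.
split.
  exists I, O; split=> // C; split.
    case=> x /negP/cov[Ix|Ox] ->; [by left; exact: compI|by right; exact: compO].
  case=> ->; first by exists x0; [exact: I_notin|rewrite compI].
  by exists x1; [exact: O_notin|rewrite compO].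
apply/seteqP; split=> z; last by move=> Iz; split; [exact: I_notin|rewrite compI].
by case=> /negP/cov[//|Oz]; rewrite compO.
Qed.

Lemma seq_bounded (c : seq Z2) : exists B : nat,
  forall a : Z2, a \in c -> `|a.1| <= B%:Z /\ `|a.2| <= B%:Z.
Proof.
elim: c => [|x c [B hB]]; first by exists 0%N.
exists (B + `|x.1|%N + `|x.2|%N)%N => a; rewrite inE => /orP[/eqP->|/hB[]]; lia.
Qed.

Lemma finite_box (B : nat) :
  finite_set [set z : Z2 | `|z.1| <= B%:Z /\ `|z.2| <= B%:Z].
Proof.
pose r : seq int := [seq i%:Z - B%:Z | i <- iota 0 (B + B).+1].
have hr (i : int) : `|i| <= B%:Z -> i \in r.
  move=> h; apply/mapP; exists (absz (i + B%:Z)); last by lia.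
  by rewrite mem_iota; lia.
apply: (@sub_finite_set _ _ [set` [seq (i, j) | i <- r, j <- r]]); last exact: finite_seq.
by move=> [i j] [/hr hi /hr hj]; exact: (allpairs_f pair hi hj).
Qed.

Section Sides.
Variables (S : seq Z2) (I O : set Z2).
Hypothesis SIO : sides S I O.

Lemma sides_winding_const (A : set Z2) c x y :
    (forall x y, A x -> A y -> joined_in c1 (~` [set` S]) x y) ->
    cycle king c -> {subset c <= S} ->
  A x -> A y -> winding x c = winding y c.
Proof.
move=> jA kc cS Ax Ay; apply/esym.
apply: (joined_ind (P := fun z => winding z c = winding x c) _ (jA _ _ Ax Ay)) => //.
move=> a b /negP na /negP nb ab <-; apply/esym; apply: winding_adj1 => //.
  by apply: contra na => /cS.
by apply: contra nb => /cS.
Qed.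

Lemma sides_winding_in c x y : cycle king c -> {subset c <= S} ->
  I x -> I y -> winding x c = winding y c.
Proof. by apply: sides_winding_const; case: SIO => _ _ _ []. Qed.

(** Being infinite, [O] has a point beyond a box containing [c], and the winding is 0 there. *)
Lemma sides_winding_out c x : cycle king c -> {subset c <= S} ->
  O x -> winding x c = false.
Proof.
move=> kc cS Ox; have [[_ infO] _ cov [_ jO] _] := SIO.
have [B hB] := seq_bounded c.
have [z Oz far] : exists2 z : Z2, O z & ~ (`|z.1| <= B%:Z /\ `|z.2| <= B%:Z).
  apply: contrapT => h; apply: infO; apply: sub_finite_set (finite_box B) => z Oz.
  by apply: contrapT => hz; apply: h; exists z.
rewrite (sides_winding_const jO kc cS Ox Oz).
have nz : z \notin c by apply/negP => /hB.
have [h|[h|[h|h]]] : B%:Z < z.2 \/ z.2 < - B%:Z \/ B%:Z < z.1 \/ z.1 < - B%:Z by lia.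
- by apply: winding_top => a /hB; lia.
- by apply: winding_bottom => // a /hB; lia.
- by apply: winding_right => a /hB; lia.
- by apply: winding_left => // a /hB; lia.
Qed.

(** The criterion for a shorter bounding curve. The dropped points of [S] become interior: they are
    joined to [I], and they do not touch [O] because [Z] winds around them but not around points of
    [O]. *)
Lemma sides_extend Z : cycle king Z -> {subset Z <= S} ->
    (forall x, x \in S -> x \notin Z -> winding x Z) ->
    (forall x, x \in S -> x \notin Z -> exists2 y, I y &
       joined_in c1 (I `|` [set t | (t \in S) && (t \notin Z)]) x y) ->
  sides Z (I `|` [set t | (t \in S) && (t \notin Z)]) O.
Proof.
move=> kZ ZS wZ jZ; have [[finI infO] [[x0 Ix0] dis] cov [jI jO] na] := SIO.
have sub : I `|` [set t | (t \in S) && (t \notin Z)] `<=` ~` [set` Z].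
  move=> z [Iz|/andP[_ /negP//]]; apply/negP.
  by apply: contraPN Iz => /ZS zS Iz; have /negP := (cov z).2 (or_introl Iz).
have subS : ~` [set` S] `<=` ~` [set` Z] by move=> z h /= /ZS.
have toI x : (I `|` [set t | (t \in S) && (t \notin Z)]) x ->
    exists2 y, I y & joined_in c1 (~` [set` Z]) x y.
  case=> [Ix|/andP[xS xZ]].
    by exists x => //; apply: joined_sub subS _; apply: jI.
  by have [y Iy j] := jZ _ xS xZ; exists y => //; apply: joined_sub j.
split.
- split=> //; rewrite finite_setU; split=> //.
  by apply: (@sub_finite_set _ _ [set` S]); [move=> t /andP[]|exact: finite_seq].
- split; first by exists x0; left.
  apply/seteqP; split=> // z [[Iz|/andP[zS _]] Oz]; first by rewrite -dis.
  by have := (cov z).2 (or_intror Oz); rewrite zS.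
- move=> z; split.
    case: (boolP (z \in S)) => [zS zZ|/cov[]]; last by right.
      by left; right; rewrite /= zS.
    by left; left.
  case=> [/sub/negP//|Oz]; apply: contra ((cov z).2 (or_intror Oz)) => /ZS //.
- split=> x y.
    move=> /toI[x' Ix' jx] /toI[y' Iy' jy]; apply: joined_trans jx _.
    by apply: joined_trans (joined_sym jy); apply: joined_sub subS _; apply: jI.
  by move=> Ox Oy; apply: joined_sub subS _; apply: jO.
- move=> x y [Ix|/andP[xS xZ]] Oy; first exact: na.
  apply/negP => a; have := wZ _ xS xZ; rewrite (winding_adj1 kZ a) //.
    by rewrite sides_winding_out.
  by apply: contra ((cov y).2 (or_intror Oy)) => /ZS.
Qed.

End Sides.

(** * Planar curves *)

Definition sedge (s : seq Z2) (a b : Z2) : bool :=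
  [&& a \in s, b \in s & (next s a == b) || (next s b == a)].

Definition planar (s : seq Z2) : Prop :=
  forall x y a b, sedge s x y -> sedge s a b -> diag x y -> uncrossed x y a b.

(** A chord that no step between points of [s] can cross: if it is diagonal, the other diagonal of
    its square has no end on [s]. *)
Definition tight (s : seq Z2) (u v : Z2) : bool :=
  adj c1 u v || [&& diag u v, corner u v \notin s & corner v u \notin s].

Lemma sedge_sym s : symmetric (sedge s).
Proof. by move=> a b; rewrite /sedge andbCA orbC. Qed.

Lemma sedge_rot n s : uniq s -> sedge (rot n s) =2 sedge s.
Proof. by move=> us a b; rewrite /sedge !mem_rot !next_rot. Qed.

Lemma sedge_rev s : uniq s -> sedge (rev s) =2 sedge s.
Proof.
move=> us a b; rewrite /sedge !mem_rev !next_rev // orbC.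
have e c d : (prev s c == d) = (next s d == c).
  by apply/eqP/eqP => <-; rewrite ?next_prev ?prev_next.
by rewrite !e.
Qed.

Lemma sedge_cycle s : uniq s -> cycle (sedge s) s.
Proof.
move=> us; have := cycle_next us; apply: (sub_in_cycle (P := mem s)); last exact/allP.
move=> a b ha hb /eqP e.
by apply/and3P; split=> //; rewrite e eqxx.
Qed.

Lemma sedgeP e s x y : cycle e s -> symmetric e -> sedge s x y -> e x y.
Proof.
move=> ce se /and3P[xs ys /orP[]/eqP<-]; first exact: next_cycle.
by rewrite se; apply: next_cycle.
Qed.

Lemma sedge_mem s x y : sedge s x y -> x \in s /\ y \in s.
Proof. by case/and3P. Qed.

Lemma planar_rot n s : uniq s -> planar s -> planar (rot n s).
Proof. by move=> us H x y a b; rewrite !sedge_rot //; apply: H. Qed.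

Lemma planar_rev s : uniq s -> planar s -> planar (rev s).
Proof. by move=> us H x y a b; rewrite !sedge_rev //; apply: H. Qed.

Lemma tight_sym s : symmetric (tight s).
Proof.
by move=> u v; rewrite /tight adj1_sym diag_sym; congr (_ || (_ && _)); rewrite andbC.
Qed.

Lemma tight_king s u v : tight s u v -> king u v.
Proof. by case/orP => [/adj1_king|/and3P[/diag_king]]. Qed.

Lemma tight_eq s t u v : s =i t -> tight s u v = tight t u v.
Proof. by move=> e; rewrite /tight !e. Qed.

Lemma diagE (x y : Z2) : diag x y ->
  (x.1 = y.1 + 1 \/ y.1 = x.1 + 1) /\ (x.2 = y.2 + 1 \/ y.2 = x.2 + 1).
Proof. by case/and3P => /kingE[? ? ? ?] /eqP ? /eqP ?; lia. Qed.

Lemma diagI (x y : Z2) :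
  (x.1 = y.1 + 1 \/ y.1 = x.1 + 1) /\ (x.2 = y.2 + 1 \/ y.2 = x.2 + 1) -> diag x y.
Proof.
move=> h; apply/and3P; split; first by apply/and4P; split; lia.
  by apply/eqP; lia.
by apply/eqP; lia.
Qed.

Lemma is_edgeE x y a b : is_edge x y a b -> a = x /\ b = y \/ a = y /\ b = x.
Proof. by case/orP=> /andP[/eqP-> /eqP->]; [left|right]. Qed.

Lemma uncrossed_flip x y a b : diag x y -> uncrossed a b x y -> uncrossed x y a b.
Proof.
move=> d; apply: contra => /is_edgeE[[-> ->]|[-> ->]].
  by rewrite /is_edge /corner /= -!surjective_pairing !eqxx ?orbT.
by rewrite /is_edge /corner /= -!surjective_pairing !eqxx ?orbT.
Qed.

Lemma crossed_diag x y a b : diag x y -> ~~ uncrossed x y a b -> diag a b.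
Proof.
move=> /diagE d; rewrite negbK => /is_edgeE[[-> ->]|[-> ->]]; apply: diagI => /=; lia.
Qed.

Lemma uncrossed_adj1 x y a b : diag x y -> adj c1 a b -> uncrossed x y a b.
Proof.
move=> d /adj1E e; apply: contraT => /(crossed_diag d)/diagE; lia.
Qed.

Lemma uncrossed_tight s u v a b : tight s u v -> diag u v ->
  a \in s -> b \in s -> uncrossed u v a b.
Proof.
move=> /orP[/adj1E e /diagE|/and3P[_ n1 n2] _ ha hb]; first lia.
apply/negP => /is_edgeE[[e _]|[e _]]; move: n1 n2; rewrite -e ha //.
Qed.

Lemma tight_uncrossed s u v x y : tight s u v -> x \in s -> y \in s -> diag x y ->
  uncrossed x y u v.
Proof.
move=> t xs ys d; case/orP: (t) => [/uncrossed_adj1|/and3P[duv _ _]]; first exact.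
by apply: uncrossed_flip => //; apply: uncrossed_tight t duv xs ys.
Qed.

(** A closed walk that steps and tight chords of [s] meet only in lattice points, so that its
    winding is constant along the arcs of [s] disjoint from it. *)
Definition clean (s c : seq Z2) : Prop :=
  cycle king c /\
  forall x y, tight s x y || sedge s x y -> diag x y -> cycle (uncrossed x y) c.

Lemma cleanP s c : cycle king s -> planar s -> {subset c <= s} ->
  cycle (fun a b => sedge s a b || tight s a b) c -> clean s c.
Proof.
move=> ks ps cs cc; split.
  apply: sub_cycle cc => a b /orP[|/tight_king //].
  exact: sedgeP king_sym.
move=> x y h d; apply: (sub_in_cycle (P := mem c)) cc; last exact/allP.
move=> a b /cs ha /cs hb.
case/orP: h => [t _|e]; first exact: uncrossed_tight t d ha hb.
have [xs ys] := sedge_mem e.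
by move=> /orP[e'|t]; [exact: ps|exact: tight_uncrossed t xs ys d].
Qed.

Lemma clean_path s c x p : cycle king s -> clean s c -> path (sedge s) x p ->
  {in x :: p, forall a, a \notin c} -> {in x :: p, forall a, winding a c = winding x c}.
Proof.
move=> ks [kc hc] pp; apply: winding_path => //.
apply: sub_path pp => a b e; rewrite (sedgeP ks king_sym e) /=.
by apply/implyP; apply: hc; rewrite e orbT.
Qed.

Lemma seq_top (s : seq Z2) t : t \in s -> exists2 z : Z2, z \in s & {in s, forall a : Z2, a.2 <= z.2}.
Proof.
elim: s t => // x [|y s] IH t _.
  by exists x; rewrite ?inE // => a; rewrite inE => /eqP->.
have [z zs hz] := IH y (mem_head _ _).
case: (lerP x.2 z.2) => h.
  exists z; first by rewrite in_cons zs orbT.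
  by move=> a; rewrite in_cons => /orP[/eqP->|/hz].
exists x; rewrite ?mem_head // => a; rewrite in_cons => /orP[/eqP->//|/hz ha].
exact: le_trans ha (ltW h).
Qed.

Lemma seq_bottom (s : seq Z2) t : t \in s -> exists2 z : Z2, z \in s & {in s, forall a : Z2, z.2 <= a.2}.
Proof.
elim: s t => // x [|y s] IH t _.
  by exists x; rewrite ?inE // => a; rewrite inE => /eqP->.
have [z zs hz] := IH y (mem_head _ _).
case: (lerP z.2 x.2) => h.
  exists z; first by rewrite in_cons zs orbT.
  by move=> a; rewrite in_cons => /orP[/eqP->|/hz].
exists x; rewrite ?mem_head // => a; rewrite in_cons => /orP[/eqP->//|/hz ha].
exact: le_trans (ltW h) ha.
Qed.

(** Extreme points of [s] have this property; they serve to evaluate windings that are only known to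
    be equal to each other. *)
Definition outer (s : seq Z2) (z : Z2) : Prop :=
  z \in s /\ forall c, cycle king c -> {subset c <= s} -> z \notin c -> winding z c = false.

Lemma outer_point (s : seq Z2) (u t : Z2) : t \in s -> t.2 != u.2 ->
  exists2 z : Z2, outer s z & z.2 != u.2.
Proof.
move=> ts /eqP n; have [h|h] : u.2 < t.2 \/ t.2 < u.2 by lia.
  have [z zs hz] := seq_top ts; exists z; last by have := hz _ ts; lia.
  by split=> // c kc cs _; apply: winding_top => a /cs/hz.
have [z zs hz] := seq_bottom ts; exists z; last by have := hz _ ts; lia.
by split=> // c kc cs zc; apply: winding_bottom => // a /cs/hz.
Qed.

(** The set spans at least three rows, while [u] and [v] lie in at most two consecutive ones, so a
    highest or a lowest point avoids both. *)
Lemma outer_point2 (s : seq Z2) (u v t t' : Z2) : t \in s -> t' \in s -> king u v ->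
  t.2 + 1 < t'.2 -> exists2 z : Z2, outer s z & (z != u) && (z != v).
Proof.
move=> ts ts' /kingE[_ _ k1 k2] h.
have [z zs hz] := seq_top ts; have [y ys hy] := seq_bottom ts.
have h1 := hz _ ts'; have h2 := hy _ ts.
have [hu|[hu hv]] : (u.2 < z.2 /\ v.2 < z.2) \/ (y.2 < u.2 /\ y.2 < v.2) by lia.
  exists z; first by split=> // c kc cs _; apply: winding_top => a /cs/hz.
  by rewrite !eqE_Z2; apply/andP; split; apply/nandP; right; lia.
exists y; first by split=> // c kc cs zc; apply: winding_bottom => // a /cs/hy.
by rewrite !eqE_Z2; apply/andP; split; apply/nandP; right; lia.
Qed.

(** * Directions around a point *)

Lemma ring_ptP (u y : Z2) : king u y -> y != u -> exists2 k, (k < 8)%N & y = ring_pt u k.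
Proof.
case: u y => [u1 u2] [y1 y2] /kingE[/= k1 k2 k3 k4] /neq_Z2/= n.
have [h1|[h1|h1]] : y1 = u1 \/ y1 = u1 + 1 \/ y1 = u1 - 1 by lia.
all: have [h2|[h2|h2]] : y2 = u2 \/ y2 = u2 + 1 \/ y2 = u2 - 1 by lia.
- lia.
- by exists 2%N => //; rewrite /ring_pt /= h1 h2 addr0.
- by exists 6%N => //; rewrite /ring_pt /= h1 h2 addr0.
- by exists 0%N => //; rewrite /ring_pt /= h1 h2 addr0.
- by exists 1%N => //; rewrite /ring_pt /= h1 h2.
- by exists 7%N => //; rewrite /ring_pt /= h1 h2.
- by exists 4%N => //; rewrite /ring_pt /= h1 h2 addr0.
- by exists 3%N => //; rewrite /ring_pt /= h1 h2.
- by exists 5%N => //; rewrite /ring_pt /= h1 h2.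
Qed.

Lemma ring_pt_eq u i j : (i < 8)%N -> (j < 8)%N -> (ring_pt u i == ring_pt u j) = (i == j).
Proof.
rewrite eqE_Z2 /= !(inj_eq (addrI _)).
by do 8?[case: i => [|i] //]; do 8?[case: j => [|j] //].
Qed.

Lemma arc_ring u i j : (i < 8)%N -> (j < 8)%N -> arc u i (ring_pt u j) = (0 < j < i)%N.
Proof.
move=> i8 j8; apply/hasP/idP => [[l]|/andP[j0 ji]].
  rewrite mem_iota => h; have l8 : (l < 8)%N by lia.
  by rewrite ring_pt_eq // => /eqP->; lia.
by exists j; rewrite ?eqxx // mem_iota; lia.
Qed.

Lemma diag_ring u k : (k < 8)%N -> diag u (ring_pt u k) = odd k.
Proof.
move=> k8; rewrite /diag /king /ring_pt /=.
do 8?[case: k k8 => [|k] k8 //]; rewrite /=; do ?[case: eqP => ?]; lia.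
Qed.

Lemma csum_spoke u k y p : u \notin y :: p ->
  csum (spoke u k) (u :: y :: p) = arc u k y (+) arc u k (last y p).
Proof.
move=> n; rewrite csum_cons /=.
have /psum_eq0-> : path (fun a b => ~~ spoke u k a b) y p.
  elim: p y n => //= z p IH y; rewrite inE negb_or => /andP[ny nz].
  rewrite IH // andbT /spoke eq_sym (negbTE ny) /=.
  by move: nz; rewrite inE negb_or eq_sym => /andP[/negbTE->].
rewrite addbF /spoke !eqxx /=.
have h a : a \in y :: p -> (a == u) = false.
  by move=> ha; apply/negbTE; apply: contraNneq n => <-.
by rewrite (h y) ?mem_head // (h (last y p)) ?mem_last // orbF.
Qed.

(** The walk passes [u] once, so only its two steps at [u] can be spokes. *)
Lemma winding_fan u i y p : cycle king (u :: y :: p) -> u \notin y :: p -> (i < 8)%N ->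
    ring_pt u i \notin u :: y :: p ->
    (diag u (ring_pt u i) -> cycle (uncrossed u (ring_pt u i)) (u :: y :: p)) ->
  winding u (u :: y :: p) (+) winding (ring_pt u i) (u :: y :: p) =
  arc u i y (+) arc u i (last y p).
Proof.
move=> kc n i8 nz h; rewrite -csum_spoke //; apply: winding_ring => //.
by rewrite -(diag_ring u i8).
Qed.

(** Adjacency among the neighbours of a point, in terms of directions: equal, one apart, or two
    apart with both directions axis-parallel. *)
Definition ring_king (i j : nat) : bool :=
  let d := ((j + 8 - i) %% 8)%N in
  [|| d == 0, d == 1, d == 7 | ((d == 2) || (d == 6)) && ~~ odd i]%N.

Lemma ring_kingP u i j : (i < 8)%N -> (j < 8)%N -> ring_king i j -> king (ring_pt u i) (ring_pt u j).
Proof.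
rewrite /king /ring_pt /=.
by do 8?[case: i => [|i] //]; do 8?[case: j => [|j] //]; move=> _ _ _ /=; lia.
Qed.

(** Whether the rays in directions [a] and [b] separate direction [i] from direction [j]: the parity
    of the number of these rays passed in turning from [i] to [j]. *)
Definition separated (a b i j : nat) : bool :=
  ((0 < a < i) (+) (0 < b < i) (+) ((0 < a < j) (+) (0 < b < j)))%N.

Section RingOrder.
Local Open Scope nat_scope.

(* Directions at [u], numbered as in [ring_pt]: the chord leaves in direction [v],
   and the curve in directions [k] and [x]; it comes back to the neighbours of [u]
   in directions [r] and [r'], by a step that separates [u] from direction [m]. *)
Lemma ring_order (r r' m v k x : nat) :
    r \in iota 0 8 -> r' \in iota 0 8 -> m \in iota 0 8 -> v \in iota 0 8 ->
    k \in iota 0 8 -> x \in iota 0 8 ->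
    ~~ odd r -> (m == (r + 1) %% 8) && (r' == (r + 2) %% 8)
                || (m == (r + 7) %% 8) && (r' == (r + 6) %% 8) ->
    v \notin [:: r; r'; m; k; x] -> k \notin [:: r; r'; m; x] -> x \notin [:: r'; m] ->
    (odd v -> [&& r != (v + 1) %% 8, r != (v + 7) %% 8,
                  r' != (v + 1) %% 8 & r' != (v + 7) %% 8]) ->
    ~~ separated r' v r x -> ~~ separated r' v r k ->
    ~~ separated x r r' v -> ~~ separated x r r' k ->
  ring_king k x || (v == (r + 4) %% 8) && (k == (m + 4) %% 8).
Proof.
pose P r r' m v k x : bool := [==> ~~ odd r,
    (m == (r + 1) %% 8) && (r' == (r + 2) %% 8)
                || (m == (r + 7) %% 8) && (r' == (r + 6) %% 8),
    v \notin [:: r; r'; m; k; x], k \notin [:: r; r'; m; x], x \notin [:: r'; m],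
    (odd v ==> [&& r != (v + 1) %% 8, r != (v + 7) %% 8,
                  r' != (v + 1) %% 8 & r' != (v + 7) %% 8]),
    ~~ separated r' v r x, ~~ separated r' v r k,
    ~~ separated x r r' v, ~~ separated x r r' k =>
   ring_king k x || (v == (r + 4) %% 8) && (k == (m + 4) %% 8)]%N.
(* Each of the six directions takes eight values, so an enumeration decides the claim. *)
have H : all (fun r => all (fun r' => all (fun m => all (fun v => all (fun k =>
    all (P r r' m v k) (iota 0 8)) (iota 0 8)) (iota 0 8)) (iota 0 8)) (iota 0 8))
    (iota 0 8) by vm_compute.
move=> hr hr' hm hv hk hx a1 a2 a3 a4 a5 a6 a7 a8 a9 a10.
move/allP/(_ _ hr)/allP/(_ _ hr')/allP/(_ _ hm)/allP/(_ _ hv)/allP/(_ _ hk)/allP/(_ _ hx): H.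
by rewrite /P a1 a2 a3 a4 a5 (introT implyP a6) a7 a8 a9 a10.
Qed.

End RingOrder.

(** * Pockets closed by a chord *)

Definition opposite (u a b : Z2) : Prop := a.1 + b.1 = u.1 + u.1 /\ a.2 + b.2 = u.2 + u.2.

Lemma ring_opp u i : (i < 8)%N -> opposite u (ring_pt u i) (ring_pt u ((i + 4) %% 8)).
Proof.
rewrite /opposite /ring_pt /=.
by do 8?[case: i => [|i] //]; move=> _ /=; split; lia.
Qed.

(** The corners of a unit square, [u] diagonally opposite to [m] and [r] to [r']. *)
Definition square (u r m r' : Z2) : Prop :=
  diag r r' /\ (u = corner r r' /\ m = corner r' r \/ u = corner r' r /\ m = corner r r').

Lemma ring_corner u r m r' : square u r m r' -> exists i j l,
  [/\ r = ring_pt u i, r' = ring_pt u j & m = ring_pt u l] /\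
  [&& ~~ odd i, i \in iota 0 8, j \in iota 0 8, l \in iota 0 8 &
      (l == (i + 1) %% 8) && (j == (i + 2) %% 8)
                || (l == (i + 7) %% 8) && (j == (i + 6) %% 8)]%N.
Proof.
case: r r' => [a b] [a' b'] [/diagE/= [[h1|h1] [h2|h2]] [[-> ->]|[-> ->]]];
  rewrite /corner /=; subst.
- by exists 2%N, 4%N, 3%N; split; [split; apply: Z2_eq => /=; lia|].
- by exists 0%N, 6%N, 7%N; split; [split; apply: Z2_eq => /=; lia|].
- by exists 6%N, 4%N, 5%N; split; [split; apply: Z2_eq => /=; lia|].
- by exists 0%N, 2%N, 1%N; split; [split; apply: Z2_eq => /=; lia|].
- by exists 2%N, 0%N, 1%N; split; [split; apply: Z2_eq => /=; lia|].
- by exists 4%N, 6%N, 5%N; split; [split; apply: Z2_eq => /=; lia|].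
- by exists 6%N, 0%N, 7%N; split; [split; apply: Z2_eq => /=; lia|].
- by exists 4%N, 2%N, 3%N; split; [split; apply: Z2_eq => /=; lia|].
Qed.

Lemma squareE u r m r' : square u r m r' ->
  [/\ adj c1 u r, adj c1 u r', adj c1 m r & adj c1 m r'].
Proof.
case=> /diagE[h1 h2] [[-> ->]|[-> ->]]; split; apply: adj1I => /=; lia.
Qed.

(* The chord [u v] cuts the curve into the arcs [R] and [K]; closed by the chord,
   [K] encloses [R] but not conversely. *)
Definition config (S : seq Z2) (I : set Z2) u R v K : Prop :=
  [/\ [/\ uniq (u :: R ++ v :: K), cycle king (u :: R ++ v :: K),
          planar (u :: R ++ v :: K) & u :: R ++ v :: K =i S],
      tight S u v,
      {in R, forall z, winding z (v :: rcons K u)},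
      {in K, forall z, winding z (u :: rcons R v) = false} &
      exists2 z, z \in R & exists2 y, I y & adj c1 z y].

Lemma path_arcs (e : rel Z2) u R v K :
  cycle e (u :: R ++ v :: K) = path e u (rcons R v) && path e v (rcons K u).
Proof. by rewrite /= rcons_cat -cat_rcons cat_path last_rcons. Qed.

Lemma config_rev S I u R v K : config S I u R v K -> config S I v (rev R) u (rev K).
Proof.
case=> [[us ks ps sS] t wR wK [z zR hz]].
have e : v :: rev R ++ u :: rev K = rot (size K) (rev (u :: R ++ v :: K)).
  rewrite rev_cons rev_cat rev_cons cat_rcons rcons_cat.
  by rewrite -(size_rev K) rot_size_cat /= cat_rcons.
split.
- rewrite e rot_uniq rev_uniq rot_cycle rev_cycle; split=> //.
  + by apply: sub_cycle ks => a b; rewrite king_sym.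
  + by apply: planar_rot; [rewrite rev_uniq|apply: planar_rev].
  + by move=> a; rewrite mem_rot mem_rev sS.
- by rewrite tight_sym.
- move=> a; rewrite mem_rev => /wR.
  by rewrite -winding_rev rev_cons rev_rcons.
- move=> a; rewrite mem_rev => /wK.
  by rewrite -winding_rev rev_cons rev_rcons.
- by exists z; rewrite ?mem_rev.
Qed.

Lemma adj1_ndiag x y : adj c1 x y -> ~~ diag x y.
Proof. by move=> /adj1E e; apply/negP => /diagE; lia. Qed.

Lemma diag_common_king (a b c : Z2) : diag a b -> king a c -> king c b ->
  [\/ c = a, c = b, c = corner a b | c = corner b a].
Proof.
case: a b c => [a1 a2] [b1 b2] [c1 c2] /diagE/= d /kingE[/= k1 k2 k3 k4].
move=> /kingE[/= k5 k6 k7 k8]; rewrite /corner /=.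
have [h1|h1] : c1 = a1 \/ c1 = b1 by lia.
all: have [h2|h2] : c2 = a2 \/ c2 = b2 by lia.
- by constructor 1; rewrite h1 h2.
- by constructor 3; rewrite h1 h2.
- by constructor 4; rewrite h1 h2.
- by constructor 2; rewrite h1 h2.
Qed.

(** * Diagonal steps of a pocket around an end of its chord *)

Section BadStep.
Variables (S : seq Z2) (I O : set Z2).
Hypothesis SIO : sides S I O.
Variables (u x r' v m : Z2) (L1 M1 K : seq Z2).
Let r := last x L1.
Let R := (x :: L1) ++ r' :: M1.
Hypothesis uRvK : config S I u R v K.
Hypothesis sq : square u r m r'.
Hypothesis mK : m \in K.

Let s := u :: R ++ v :: K.
(** The step from [r] to [r'] passes between [u] and [m]. Joining [u] to [r] and to [r'] splits the
    pocket into two lobes and a triangle; the lobe [Cb] contains the chord from [v] to [u]. *)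
Let Ca := u :: x :: L1.
Let Cb := u :: r' :: rcons M1 v.

Let us : uniq s. Proof. by case: uRvK => [[]]. Qed.
Let ks : cycle king s. Proof. by case: uRvK => [[]]. Qed.
Let ps : planar s. Proof. by case: uRvK => [[]]. Qed.
Let sS : s =i S. Proof. by case: uRvK => [[]]. Qed.
Let tuv : tight S u v. Proof. by case: uRvK. Qed.

Lemma lobe_parts (e : rel Z2) : cycle e s ->
  [/\ e u x /\ path e x L1, e r r' /\ path e r' M1, e (last r' M1) v,
      path e v K & e (last v K) u].
Proof.
rewrite path_arcs rcons_cat cat_path /= !rcons_path.
by move=> /andP[/andP[/andP[-> ->] /andP[-> /andP[-> ->]]] /andP[-> ->]].
Qed.

Lemma Ca_sub : {subset Ca <= s}.
Proof. by move=> a; rewrite !inE !mem_cat !inE => /or3P[]->; rewrite ?orbT. Qed.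

Lemma Cb_sub : {subset Cb <= s}.
Proof.
by move=> a; rewrite !inE mem_rcons !mem_cat !inE => /or4P[]->; rewrite ?orbT.
Qed.

Lemma Ca_notin a : a \in r' :: M1 ++ v :: K -> a \notin Ca.
Proof.
move=> ha; apply: contraL us => hb; rewrite /s /R -catA -cat_cons cat_uniq.
by rewrite negb_and orbC negb_and negbK; apply/orP; left; apply/orP; left; apply/hasP; exists a.
Qed.

Lemma Cb_notin a : a \in (x :: L1) ++ K -> a \notin Cb.
Proof.
move=> ha; apply: contraL us => hb.
have e : s = u :: (x :: L1) ++ (r' :: rcons M1 v) ++ K.
  by rewrite /s /R -catA -rcons_cons cat_rcons.
have -> : uniq s = uniq (Cb ++ (x :: L1) ++ K).
  by rewrite e; apply: perm_uniq; rewrite perm_cons; apply/permEl/perm_catCA.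
rewrite cat_uniq negb_and orbC negb_and negbK; apply/orP; left; apply/orP; left.
by apply/hasP; exists a.
Qed.

Lemma king_parts : [/\ king u x /\ path king x L1, king r r' /\ path king r' M1,
  king (last r' M1) v, path king v K & king (last v K) u].
Proof. exact: lobe_parts ks. Qed.

Lemma sedge_parts : [/\ sedge s u x /\ path (sedge s) x L1,
  sedge s r r' /\ path (sedge s) r' M1, sedge s (last r' M1) v,
  path (sedge s) v K & sedge s (last v K) u].
Proof. exact: lobe_parts (sedge_cycle us). Qed.

Let tight_s a b : tight s a b = tight S a b. Proof. exact: tight_eq. Qed.

Lemma Ca_clean : clean s Ca.
Proof.
have [aur aur' amr amr'] := squareE sq.
have [[e1 e2] _ _ _ _] := sedge_parts.
apply: cleanP => //; first exact: Ca_sub.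
rewrite /= e1 /= rcons_path /=; apply/andP; split.
  by apply: sub_path e2 => a b ->.
by rewrite -/r /tight adj1_sym aur orbT.
Qed.

Lemma Cb_clean : clean s Cb.
Proof.
have [aur aur' amr amr'] := squareE sq.
have [_ [_ e2] e3 _ _] := sedge_parts.
apply: cleanP => //; first exact: Cb_sub.
rewrite /= {1}/tight aur' orbT /= !rcons_path /= last_rcons e3 /=.
rewrite tight_sym tight_s tuv orbT andbT andbT.
by apply: sub_path e2 => a b ->.
Qed.

Lemma winding_lobes z : z \notin [:: u; r; r'] ->
  winding z (u :: rcons R v) = winding z Ca (+) winding z Cb.
Proof.
move=> nz; have [aur aur' amr amr'] := squareE sq; have [_ [krr' _] _ _ _] := king_parts.
have := winding_triangle (adj1_king aur) krr' (adj1_king aur') nz.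
rewrite /winding /R rcons_cat !csum_cons /= !psum_cat !last_cat /= !psum_rcons.
rewrite !last_rcons -/r (crossC z r u) (crossC z r' u).
move: (cross z u x) (psum _ x L1) (cross z r r') (psum _ r' M1) (cross z u r) (cross z u r').
by move: (cross z v u) (cross z (last r' M1) v) => [] [] [] [] [] [] [] [].
Qed.

Let mCa : m \notin Ca.
Proof. by apply: Ca_notin; rewrite inE mem_cat inE mK !orbT. Qed.
Let mCb : m \notin Cb.
Proof. by apply: Cb_notin; rewrite mem_cat mK orbT. Qed.

(** The point [m] is on [K], so the pocket has winding 0 around it, and the pocket is the sum of the
    two lobes. *)
Lemma winding_m : winding m Ca = winding m Cb.
Proof.
have [_ _ _ wK _] := uRvK; have := wK _ mK.
rewrite winding_lobes; first by case: (winding m Ca); case: (winding m Cb).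
move: mCa mCb; rewrite !inE !negb_or => /and3P[-> h1 h2] /and3P[_ -> _].
rewrite andbT /=; apply: contraNneq mCa => ->; exact: (mem_last u (x :: L1)).
Qed.

Lemma K_const c : clean s c -> {in K, forall z, z \notin c} ->
  {in K, forall z, winding z c = winding m c}.
Proof.
move=> cc n; have [_ _ _ eK _] := sedge_parts.
case: K mK n eK => // k K' mK' n /= /andP[_ pk] z zK.
have H := clean_path ks cc pk n.
by rewrite (H z) // (H m).
Qed.

Lemma Ca_K z : z \in K -> winding z Ca = winding m Ca.
Proof.
apply: K_const; first exact: Ca_clean.
by move=> a ha; apply: Ca_notin; rewrite inE mem_cat inE ha !orbT.
Qed.

Lemma Cb_K z : z \in K -> winding z Cb = winding m Ca.
Proof.
rewrite winding_m; apply: K_const; first exact: Cb_clean.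
by move=> a ha; apply: Cb_notin; rewrite mem_cat ha !orbT.
Qed.

Lemma Cb_L z : z \in x :: L1 -> winding z Cb = winding m Ca.
Proof.
have [aur aur' amr amr'] := squareE sq; have [[_ e2] _ _ _ _] := sedge_parts.
have n a : a \in x :: L1 -> a \notin Cb by move=> ha; apply: Cb_notin; rewrite mem_cat ha.
move=> zL; have H := clean_path ks Cb_clean e2 n.
rewrite (H z zL) -(H r (mem_last _ _)) winding_m; apply/esym.
by apply: winding_adj1 => //; [case: Cb_clean|apply: n (mem_last _ _)].
Qed.

Lemma Ca_M z : z \in r' :: rcons M1 v -> winding z Ca = winding m Ca.
Proof.
have [aur aur' amr amr'] := squareE sq; have [_ [_ e2] e3 _ _] := sedge_parts.
have n a : a \in r' :: rcons M1 v -> a \notin Ca.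
  rewrite inE mem_rcons inE => ha; apply: Ca_notin; rewrite inE mem_cat inE.
  by case/or3P: ha => ->; rewrite ?orbT.
have e : path (sedge s) r' (rcons M1 v) by rewrite rcons_path e2.
move=> zM; rewrite (clean_path ks Ca_clean e n zM); apply/esym.
by apply: winding_adj1 => //; [case: Ca_clean|apply: n; apply: mem_head].
Qed.

(** By the preceding lemmas each lobe has one and the same winding around all points of [s] off that
    lobe. An extreme point of [s] other than [u] shows that it is 0. *)
Lemma lobe_out : winding m Ca = false.
Proof.
have [aur aur' amr amr'] := squareE sq.
(* The points [r] and [r'] lie in different rows, so one of them is not in the row of [u]. *)
have [t ts tu] : exists2 t, t \in s & t.2 != u.2.
  have [h|h] : r.2 != u.2 \/ r'.2 != u.2.
  - case: sq => /and3P[_ _ nrr] _; case: (eqVneq r.2 u.2) nrr => [->|]; last by left.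
    by rewrite eq_sym; right.
  - by exists r => //; rewrite inE mem_cat (mem_cat _ (x :: L1)) mem_last !orbT.
  - by exists r' => //; rewrite inE mem_cat (mem_cat _ (x :: L1)) !inE eqxx !orbT.
have [z [zs hz] zu] := outer_point ts tu.
have [kCa _] := Ca_clean; have [kCb _] := Cb_clean.
have zCa := hz _ kCa Ca_sub; have zCb := hz _ kCb Cb_sub.
have {}zu : z != u by apply: contraNneq zu => ->.
move: zs; rewrite in_cons (negbTE zu) orFb /R -catA mem_cat => /orP[zL|].
  by rewrite -(Cb_L zL); apply: zCb; apply: Cb_notin; rewrite mem_cat zL.
move=> zr; have n := Ca_notin zr; move: zr.
have -> : (r' :: M1) ++ v :: K = (r' :: rcons M1 v) ++ K by rewrite /= cat_rcons.
rewrite mem_cat => /orP[zM|zK]; first by rewrite -(Ca_M zM) zCa.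
by rewrite -(Ca_K zK) zCa.
Qed.

(** The chord from [u] to [r'] closes off the shorter pocket [x :: L1]. The complementary walk is
    the old one plus the lobe [Cb], which does not wind around [x :: L1]. *)
Lemma reduce_lobe : (exists2 z, z \in x :: L1 & exists2 y, I y & adj c1 z y) ->
  config S I u (x :: L1) r' (M1 ++ v :: K).
Proof.
move=> hL; have [aur aur' amr amr'] := squareE sq.
have [_ [krr' _] _ _ _] := king_parts.
have e : u :: (x :: L1) ++ r' :: M1 ++ v :: K = s by rewrite /s /R -catA.
have [_ _ wR wK _] := uRvK.
split; rewrite ?e //; first by rewrite /tight aur'.
- move=> z zL; have <- : winding z (v :: rcons K u) (+) winding z Cb
      = winding z (r' :: rcons (M1 ++ v :: K) u).
    rewrite /winding /Cb !csum_cons /= !last_rcons rcons_cat psum_cat /= !psum_rcons.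
    rewrite (crossC z v u); move: (psum _ v K) (psum _ r' M1) (cross z (last v K) u).
    by move: (cross z u v) (cross z u r') (cross z (last r' M1) v) => [] [] [] [] [] [].
  by rewrite (Cb_L zL) lobe_out addbF wR // mem_cat zL.
- move=> z zM; have n : z \notin Ca.
    by apply: Ca_notin; rewrite inE zM orbT.
  have nz : z \notin [:: u; r; r'].
    rewrite !inE !negb_or; apply/and3P; split.
    + by apply: contraNneq n => ->; rewrite mem_head.
    + by apply: contraNneq n => ->; rewrite inE mem_last orbT.
    + apply: contraTneq us => ez; rewrite -e -ez -[u :: _]/((u :: x :: L1) ++ _).
      by rewrite cat_uniq (cons_uniq z) zM !andbF.
  have -> : winding z (u :: rcons (x :: L1) r') = winding z Ca (+) winding z [:: u; r; r'].
    rewrite /winding /Ca !csum_cons /= !last_rcons psum_rcons -/r (crossC z u r).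
    move: (cross z u x) (psum _ x L1) (cross z r r').
    by move: (cross z r' u) (cross z r u) => [] [] [] [] [].
  rewrite (winding_triangle (adj1_king aur) krr' (adj1_king aur') nz) addbF.
  move: zM; rewrite mem_cat inE orbA => /orP[zM|zK].
    by rewrite Ca_M ?lobe_out // inE mem_rcons inE orbC [_ || (z \in M1)]orbC zM.
  by rewrite Ca_K // lobe_out.
Qed.

Let k := last v K.

Lemma K_last : k \in K.
Proof. by rewrite /k; case: (K) mK => // y K' _; exact: (mem_last y K'). Qed.

Let xk : x != k.
Proof.
apply: contraNneq (Cb_notin (a := k) _); last by rewrite mem_cat K_last orbT.
move=> e; exfalso; have : k \notin Ca by apply: Ca_notin; rewrite inE mem_cat inE K_last !orbT.
by rewrite -e !inE eqxx orbT.
Qed.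

(** Here [u] is moved elsewhere on the curve: it leaves its place between [k] and [x], which are
    then joined directly, and is inserted between [r] and [r']. The part [r' :: M1] remains as the
    pocket. *)
Lemma reduce_swap : king k x ->
    (exists2 z, z \in r' :: M1 & exists2 y, I y & adj c1 z y) ->
  config S I u (r' :: M1) v (K ++ x :: L1).
Proof.
move=> kkx hM; have [aur aur' amr amr'] := squareE sq.
have [[kux _] _ _ _ kku] := king_parts.
have [[e1 p1] [e2 p2] e3 p4 e5] := sedge_parts.
have [_ _ wR wK _] := uRvK.
pose s' := u :: (r' :: M1) ++ v :: K ++ x :: L1.
have pss' : perm_eq s s'.
  rewrite /s /s' perm_cons /R -catA -[v :: K ++ _]/((v :: K) ++ (x :: L1)).
  by rewrite perm_catC catA.
have us' : uniq s' by rewrite -(perm_uniq pss').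
have u_notin a : a \in (x :: L1) ++ (r' :: M1) ++ v :: K -> a != u.
  rewrite catA => ha; apply: contraTneq us => ea.
  by rewrite /s cons_uniq -ea ha.
(* This relation holds for all steps of the new curve and sorts them into three kinds, so that
   planarity can be checked kind by kind. *)
pose E a b := [&& sedge s a b, a != u & b != u] || adj c1 a b || is_edge k x a b.
have Esym : symmetric E.
  by move=> a b; rewrite /E sedge_sym adj1_sym is_edgeC [_ && (b != u)]andbC.
have liftE y p : {subset y :: p <= (x :: L1) ++ (r' :: M1) ++ v :: K} ->
    path (sedge s) y p -> path E y p.
  move=> hs; apply: (sub_in_path (P := [pred a | a != u])).
    by move=> a b; rewrite !inE /E => -> -> ->.
  by apply/allP => a /hs/u_notin.
have cE : cycle E s'.
  rewrite path_arcs rcons_cat cat_path /= !rcons_path.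
  have -> : E u r' by rewrite /E aur' orbT.
  have -> : E r u by rewrite /E adj1_sym aur orbT.
  have -> : E k x by rewrite /E /is_edge !eqxx orbT.
  have -> : E (last r' M1) v.
    rewrite /E e3 !u_notin // !mem_cat ?mem_last ?orbT //.
    by rewrite mem_head !orbT.
  rewrite !andbT !liftE //.
  + by move=> a ha; rewrite mem_cat ha.
  + by move=> a ha; rewrite !mem_cat ha !orbT.
  + by move=> a ha; rewrite !mem_cat ha orbT.
have xu : x != u by apply: u_notin; rewrite mem_cat mem_head.
have ku : k != u by apply: u_notin; rewrite !mem_cat [k \in v :: K]in_cons K_last !orbT.
(* As [u] is adjacent to both [k] and [x], it is a corner of their square when they are diagonal
   neighbours. A step crossing theirs would then end at [u]. *)
have uc p q : diag p q -> p != u -> q != u -> uncrossed p q k x.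
  move=> d pu qu; apply/negP => h; have dkx : diag k x.
    by apply: crossed_diag d _; rewrite negbK.
  case: (diag_common_king dkx kku kux) => [e|e|e|e].
  - by rewrite e eqxx in ku.
  - by rewrite e eqxx in xu.
  - case/is_edgeE: h => -[h1 h2]; rewrite h1 h2 /corner /= -surjective_pairing in e.
      by rewrite e eqxx in pu.
    by rewrite e eqxx in qu.
  - case/is_edgeE: h => -[h1 h2]; rewrite h1 h2 /corner /= -surjective_pairing in e.
      by rewrite e eqxx in qu.
    by rewrite e eqxx in pu.
have ps' : planar s'.
  move=> p q a b /(sedgeP cE Esym) epq /(sedgeP cE Esym) eab d.
  case/orP: epq => [/orP[/and3P[epq pu qu]|apq]|kpq].
  - case/orP: eab => [/orP[/and3P[eab au bu]|aab]|kab].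
    + exact: ps.
    + exact: uncrossed_adj1.
    + by case/is_edgeE: kab => -[-> ->]; [|rewrite uncrossedC]; apply: uc.
  - by rewrite (negbTE (adj1_ndiag apq)) in d.
  - have kx_old : diag k x -> a != u -> b != u -> uncrossed k x a b.
      move=> dkx au bu; apply: contraT => h.
      by move: (h); rewrite (uncrossed_flip dkx) ?uc // (crossed_diag dkx h).
    have kx_self : diag k x -> uncrossed k x k x.
      move=> /and3P[_ /eqP n1 /eqP n2]; apply/negP => /is_edgeE[[h _]|[h _]].
        by apply: n2; rewrite h.
      by apply: n1; rewrite h.
    case/orP: eab => [/orP[/and3P[eab au bu]|aab]|kab].
    + by case/is_edgeE: kpq d => -[-> ->] d; [|rewrite uncrossed_sym]; apply: kx_old;
         rewrite // diag_sym.
    + exact: uncrossed_adj1.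
    + case/is_edgeE: kpq d => -[-> ->] d; case/is_edgeE: kab => -[-> ->];
        rewrite ?(uncrossedC _ _ x k) ?(uncrossed_sym x k); apply: kx_self;
        by rewrite // diag_sym.
have sS' : s' =i S by move=> a; rewrite -(perm_mem pss') sS.
split => //.
- by split=> //; apply: sub_cycle cE => a b; case/orP => [/orP[/and3P[/(sedgeP ks king_sym)]|/adj1_king]|/is_edgeE[[-> ->]|[-> ->]]] //; rewrite king_sym.
- move=> z zM; have n := Ca_notin (a := z).
  have {}n : z \notin Ca by apply: Ca_notin; rewrite -cat_cons mem_cat zM.
  have -> : winding z (v :: rcons (K ++ x :: L1) u)
      = winding z (v :: rcons K u) (+) winding z Ca (+) winding z [:: u; k; x].
    rewrite /winding /Ca !csum_cons /= !last_rcons rcons_cat psum_cat /= !psum_rcons.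
    rewrite -/k -/r (crossC z k u) (crossC z x u).
    move: (psum _ v K) (psum _ x L1) (cross z k x) (cross z r u) (cross z u v) (cross z u x).
    by move: (cross z u k) => [] [] [] [] [] [] [].
  rewrite wR ?mem_cat ?zM ?orbT // (Ca_M _) ?lobe_out; last first.
    by move: zM; rewrite !inE mem_rcons inE => /orP[]->; rewrite ?orbT.
  rewrite winding_triangle // 1?king_sym //.
  rewrite !inE !negb_or; apply/and3P; split.
  + by apply: contraNneq n => ->; rewrite mem_head.
  + apply: contraTneq us => ez; rewrite /s cons_uniq cat_uniq.
    have -> // : has (mem R) (v :: K); last by rewrite !andbF.
    by apply/hasP; exists z; [rewrite ez inE K_last orbT|rewrite /= mem_cat zM orbT].
  + by apply: contraNneq n => ->; rewrite !inE eqxx orbT.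
- move=> z; rewrite mem_cat => /orP[zK|zL]; first by rewrite Cb_K // lobe_out.
  by rewrite Cb_L // lobe_out.
Qed.


(** The directions next to an odd direction [j] lead to the two corners of the diagonal chord. *)
Lemma tight_ring (j : nat) y : (j < 8)%N -> odd j -> tight S u (ring_pt u j) -> y \in S ->
  y != ring_pt u ((j + 1) %% 8) /\ y != ring_pt u ((j + 7) %% 8).
Proof.
move=> j8 oj t yS; have d : diag u (ring_pt u j) by rewrite diag_ring.
case/orP: t => [/adj1_ndiag|/and3P[_ n1 n2]]; first by rewrite d.
have : ring_pt u ((j + 1) %% 8) \notin S /\ ring_pt u ((j + 7) %% 8) \notin S.
  move: n1 n2; rewrite /corner /ring_pt /=.
  move: j8 oj; clear; do 8?[case: j => [|j] //]; move=> _ _ /=;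
  by rewrite /= ?addr0 => *; split.
by case=> n3 n4; split; apply: contraTneq yS => ->.
Qed.

(** The right-hand side does not depend on [i]. Hence two such directions of winding 0 are never
    separated by the two steps of the walk at [u]. *)
Lemma fan_arc i y p : clean s (u :: y :: p) -> u \notin y :: p ->
    (i < 8)%N -> ring_pt u i \notin u :: y :: p ->
    tight s u (ring_pt u i) || sedge s u (ring_pt u i) ->
    winding (ring_pt u i) (u :: y :: p) = false ->
  arc u i y (+) arc u i (last y p) = winding u (u :: y :: p).
Proof.
move=> [kc hc] n i8 nz tz wz.
rewrite -winding_fan // ?wz ?addbF // => d; exact: hc.
Qed.

(** By [fan_arc] the directions at [u] of [r], [x] and [k] are on one side of the lobe [Cb], and
    those of [r'], [v] and [k] on one side of [Ca]. By [ring_order] these constraints leave only two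
    cases. *)
Lemma lobe_order : king k x \/ opposite u r v /\ opposite u m k.
Proof.
have [aur aur' amr amr'] := squareE sq.
have [[kux _] _ _ _ kku] := king_parts.
have [[e1 p1] [e2 p2] e3 p4 e5] := sedge_parts.
have e : s = u :: (x :: L1) ++ (r' :: rcons M1 v) ++ K.
  by rewrite /s /R -catA -rcons_cons cat_rcons.
have uL : u \notin x :: L1.
  by move: us; rewrite e cons_uniq mem_cat negb_or => /andP[/andP[]].
have uM : u \notin r' :: rcons M1 v.
  by move: us; rewrite e cons_uniq !mem_cat !negb_or => /andP[/and3P[]].
have uK : u \notin K.
  by move: us; rewrite e cons_uniq !mem_cat !negb_or => /andP[/and3P[]].
have rL : r \in x :: L1 by apply: mem_last.
have vM : v \in r' :: rcons M1 v by rewrite inE mem_rcons mem_head orbT.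
have nLM a b : a \in x :: L1 -> b \in r' :: rcons M1 v -> a != b.
  move=> ha hb; apply: contraTneq us => eab; rewrite e cons_uniq cat_uniq.
  have -> // : has (mem (x :: L1)) ((r' :: rcons M1 v) ++ K); last by rewrite !andbF.
  by apply/hasP; exists b; rewrite ?mem_cat ?hb // -eab.
have nLK a b : a \in x :: L1 -> b \in K -> a != b.
  move=> ha hb; apply: contraTneq us => eab; rewrite e cons_uniq cat_uniq.
  have -> // : has (mem (x :: L1)) ((r' :: rcons M1 v) ++ K); last by rewrite !andbF.
  by apply/hasP; exists b; rewrite ?mem_cat ?hb ?orbT // -eab.
have nMK a b : a \in r' :: rcons M1 v -> b \in K -> a != b.
  move=> ha hb; apply: contraTneq us => eab; rewrite e cons_uniq !cat_uniq.
  have -> // : has (mem (r' :: rcons M1 v)) K; last by rewrite !andbF.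
  by apply/hasP; exists b; rewrite // -eab.
have u_neq a (c : seq Z2) : u \notin c -> a \in c -> a != u.
  by move=> hu ha; apply: contraNneq hu => <-.
(* Otherwise the step from [k] to [u] would cross the step from [r] to [r']. *)
have mk : k != m.
  apply/eqP => ekm; have : uncrossed r r' k u by exact: ps e2 e5 (proj1 sq).
  by rewrite /uncrossed ekm /is_edge; case: sq => _ [[-> ->]|[-> ->]]; rewrite !eqxx ?orbT.
have r'v : r' != v.
  have : uniq (r' :: rcons M1 v).
    by move: us; rewrite e cons_uniq !cat_uniq => /and4P[_ _ _ /and3P[]].
  by rewrite cons_uniq mem_rcons inE negb_or => /andP[/andP[]].
have [i [j [l [[er er' em] /and5P[oi i8 j8 l8 hij]]]]] := ring_corner sq.
have [jv jv8 ev] := ring_ptP (tight_king tuv) (u_neq _ _ uM vM).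
have [jk jk8 ek] : exists2 q, (q < 8)%N & k = ring_pt u q.
  by apply: ring_ptP (u_neq _ _ uK K_last); rewrite king_sym.
have [jx jx8 ex] := ring_ptP kux (u_neq _ _ uL (mem_head _ _)).
have in8 q : (q < 8)%N -> q \in iota 0 8 by move=> h; rewrite mem_iota.
have lt8 q : q \in iota 0 8 -> (q < 8)%N by rewrite mem_iota.
have neq a b p q : a = ring_pt u p -> b = ring_pt u q -> a != b -> p != q.
  by move=> -> ->; apply: contraNneq => ->.
have inS a : a \in s -> a \in S by rewrite sS.
have subL : {subset x :: L1 <= s} by move=> a ha; rewrite e in_cons !mem_cat ha !orbT.
have subM : {subset r' :: rcons M1 v <= s} by move=> a ha; rewrite e in_cons !mem_cat ha !orbT.
have fanCb q : (q < 8)%N -> ring_pt u q \in (x :: L1) ++ K ->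
    tight s u (ring_pt u q) || sedge s u (ring_pt u q) ->
    arc u q r' (+) arc u q v = winding u Cb.
  move=> q8 hq t; have n := Cb_notin hq.
  have := @fan_arc q r' (rcons M1 v) Cb_clean uM q8 n t.
  rewrite last_rcons; apply; move: hq; rewrite mem_cat => /orP[/Cb_L|/Cb_K] ->;
  exact: lobe_out.
have fanCa q : (q < 8)%N -> ring_pt u q \in (r' :: rcons M1 v) ++ K ->
    tight s u (ring_pt u q) || sedge s u (ring_pt u q) ->
    arc u q x (+) arc u q r = winding u Ca.
  move=> q8 hq t; have n : ring_pt u q \notin Ca.
    by apply: Ca_notin; move: hq; rewrite /= cat_rcons.
  apply: (@fan_arc q x L1 Ca_clean uL q8 n t).
  by move: hq; rewrite mem_cat => /orP[/Ca_M|/Ca_K] ->; exact: lobe_out.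
have sep a b p q w : (a < 8)%N -> (b < 8)%N -> (p < 8)%N -> (q < 8)%N ->
    arc u p (ring_pt u a) (+) arc u p (ring_pt u b) = w ->
    arc u q (ring_pt u a) (+) arc u q (ring_pt u b) = w -> ~~ separated a b p q.
  by move=> a8 b8 p8 q8; rewrite !arc_ring // /separated => -> ->; rewrite addbb.
have tr : tight s u r || sedge s u r by rewrite /tight aur.
have tr' : tight s u r' || sedge s u r' by rewrite /tight aur'.
have tv : tight s u v || sedge s u v by rewrite tight_s tuv.
have tx : tight s u x || sedge s u x by rewrite e1 orbT.
have tk : tight s u k || sedge s u k by rewrite sedge_sym e5 orbT.
have Fr : arc u i r' (+) arc u i v = winding u Cb.
  by apply: fanCb; rewrite -?er ?lt8 // mem_cat rL.
have Fx : arc u jx r' (+) arc u jx v = winding u Cb.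
  by apply: fanCb; rewrite -?ex // mem_cat mem_head.
have Fk : arc u jk r' (+) arc u jk v = winding u Cb.
  by apply: fanCb; rewrite -?ek // mem_cat K_last orbT.
have Gr' : arc u j x (+) arc u j r = winding u Ca.
  by apply: fanCa; rewrite -?er' ?lt8 // mem_cat mem_head.
have Gv : arc u jv x (+) arc u jv r = winding u Ca.
  by apply: fanCa; rewrite -?ev // mem_cat vM.
have Gk : arc u jk x (+) arc u jk r = winding u Ca.
  by apply: fanCa; rewrite -?ek // mem_cat K_last orbT.
have kK := K_last.
have xL : x \in x :: L1 by apply: mem_head.
have r'M : r' \in r' :: rcons M1 v by apply: mem_head.
rewrite er' ev in Fr Fx Fk; rewrite ex er in Gr' Gv Gk.
have H : ring_king jk jx || (jv == (i + 4) %% 8)%N && (jk == (l + 4) %% 8)%N.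
  apply: (@ring_order i j l jv jk jx); rewrite ?(in8 jv) ?(in8 jk) ?(in8 jx) //.
  - rewrite !inE !negb_or (neq _ _ _ _ ev er) ?(neq _ _ _ _ ev er') ?(neq _ _ _ _ ev em)
       ?(neq _ _ _ _ ev ek) ?(neq _ _ _ _ ev ex) //.
    + by rewrite eq_sym nLM.
    + exact: nMK.
    + exact: nMK.
    + by rewrite eq_sym.
    + by rewrite eq_sym nLM.
  - rewrite !inE !negb_or (neq _ _ _ _ ek er) ?(neq _ _ _ _ ek er') ?(neq _ _ _ _ ek em)
       ?(neq _ _ _ _ ek ex) //.
    + by rewrite eq_sym nLK.
    + by rewrite eq_sym nMK.
    + by rewrite eq_sym nLK.
  - rewrite !inE !negb_or (neq _ _ _ _ ex er') ?(neq _ _ _ _ ex em) //.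
    + exact: nLK.
    + exact: nLM.
  - move=> ojv; have tvj : tight S u (ring_pt u jv) by rewrite -ev.
    have [h1 h2] := tight_ring jv8 ojv tvj (inS _ (subL _ rL)).
    have [h3 h4] := tight_ring jv8 ojv tvj (inS _ (subM _ r'M)).
    rewrite (neq _ _ _ _ er (erefl _) h1) (neq _ _ _ _ er (erefl _) h2).
    by rewrite (neq _ _ _ _ er' (erefl _) h3) (neq _ _ _ _ er' (erefl _) h4).
  - by apply: (sep _ _ _ _ _ _ _ _ _ Fr Fx) => //; exact: lt8.
  - by apply: (sep _ _ _ _ _ _ _ _ _ Fr Fk) => //; exact: lt8.
  - by apply: (sep _ _ _ _ _ _ _ _ _ Gr' Gv) => //; exact: lt8.
  - by apply: (sep _ _ _ _ _ _ _ _ _ Gr' Gk) => //; exact: lt8.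
case/orP: H => [/(@ring_kingP u)|/andP[/eqP ejv /eqP ejk]].
  by rewrite -ex -ek => h; left; apply: h.
right; rewrite er ev em ek ejv ejk; split; apply: ring_opp; exact: lt8.
Qed.

End BadStep.

Lemma corner_adj1 a b c : diag a b -> c = corner a b \/ c = corner b a ->
  adj c1 a c /\ adj c1 c b.
Proof. by move=> /diagE[h1 h2] [|] ->; split; apply: adj1I => /=; lia. Qed.

Lemma diag_corner a b : diag a b -> diag (corner a b) (corner b a).
Proof. by move=> /diagE[h1 h2]; apply: diagI => /=; lia. Qed.

Lemma consec_path (T : eqType) (e : rel T) x p :
  (forall p1 y p2, p = p1 ++ y :: p2 -> e (last x p1) y) -> path e x p.
Proof.
elim: p x => //= y p IH x H; rewrite (H [::] y p) //=.
by apply: IH => p1 z p2 ep; apply: (H (y :: p1) z p2); rewrite ep.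
Qed.

Lemma psum_is_edge0 a b x p : a \notin x :: p -> psum (is_edge a b) x p = false.
Proof.
move=> n; apply: psum_eq0; elim: p x n => //= y p IH x; rewrite inE negb_or => /andP[ax n].
rewrite IH // andbT /is_edge eq_sym (negbTE ax) /=.
by move: n; rewrite inE negb_or eq_sym => /andP[/negbTE-> _]; rewrite andbF.
Qed.

Lemma psum_is_edgeC a b x p : psum (is_edge a b) x p = psum (is_edge b a) x p.
Proof. by elim: p x => //= y p IH x; rewrite is_edge_sym IH. Qed.

Lemma csum_is_edge1 x p r r' q : uniq (x :: p ++ r :: r' :: q) ->
  csum (is_edge r r') (x :: p ++ r :: r' :: q).
Proof.
move=> us; have e : x :: p ++ r :: r' :: q = (x :: rcons p r) ++ (r' :: q).
  by rewrite /= cat_rcons.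
have nx : x \notin p ++ r :: r' :: q by move: us; rewrite cons_uniq => /andP[].
have xr : x == r = false.
  by apply/negbTE; apply: contraNneq nx => ->; rewrite mem_cat mem_head orbT.
have xr' : x == r' = false.
  by apply/negbTE; apply: contraNneq nx => ->; rewrite mem_cat !inE eqxx !orbT.
have r'n : r' \notin x :: rcons p r.
  move: us; rewrite e cat_uniq => /and3P[_ /hasPn h _]; exact: h (mem_head _ _).
have rn : r \notin r' :: q.
  move: us; rewrite e cat_uniq => /and3P[_ /hasPn h _]; apply/negP => /h /=.
  by rewrite inE mem_rcons mem_head orbT.
rewrite csum_cons -cat_rcons psum_cat last_rcons /=.
rewrite (@psum_is_edge0 r r' r' q rn).
have -> : psum (is_edge r r') x (rcons p r) = false.
  by rewrite psum_is_edgeC psum_is_edge0.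
rewrite [in X in _ (+) X]/is_edge xr xr' !andbF /is_edge !eqxx.
by rewrite addbF.
Qed.

(** A diagonal step of the pocket whose corners are [u] and a point of [K]: if both stay on the
    curve, no corner becomes interior to connect the ends of the step. *)
Definition bad (u : Z2) (R K : seq Z2) (r r' m : Z2) : Prop :=
  [/\ exists p1 p2, R = p1 ++ r :: r' :: p2, square u r m r' & m \in K].

Lemma bad_mem u R K r r' m : bad u R K r r' m -> r \in R /\ r' \in R.
Proof. by case=> -[p1 [p2 ->]] _ _; rewrite !mem_cat !inE !eqxx !orbT. Qed.

Definition reducible (S : seq Z2) (I : set Z2) (n : nat) : Prop :=
  exists u R v K, config S I u R v K /\ (size R < n)%N.

(** The part of [R] that touches the interior becomes a shorter pocket: the part before the step by
    [reduce_lobe], the part after it by [reduce_swap]. Only the second can fail, in the exceptional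
    case of [lobe_order]. *)
Lemma bad_cases S I O u R v K r r' m : sides S I O -> config S I u R v K ->
  bad u R K r r' m ->
  reducible S I (size R) \/ opposite u r v /\ opposite u m (last v K).
Proof.
move=> SIO cf [[p1 [p2 eR]] sq mK].
have [x [L1 [eL er]]] : exists x L1, rcons p1 r = x :: L1 /\ r = last x L1.
  case: p1 {eR} => [|x p1]; first by exists r, [::].
  by exists x, (rcons p1 r); rewrite last_rcons.
have {}eR : R = (x :: L1) ++ r' :: p2 by rewrite -eL cat_rcons.
subst r; rewrite eR in cf *.
have [z zR hz] : exists2 z, z \in (x :: L1) ++ r' :: p2 & exists2 y, I y & adj c1 z y.
  by case: cf.
move: zR; rewrite mem_cat => /orP[zL|zM].
  left; exists u, (x :: L1), r', (p2 ++ v :: K); split.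
    by apply: reduce_lobe cf sq mK _; exists z.
  by rewrite size_cat /= -addn1 leq_add2l.
have [kx|op] := lobe_order cf sq mK; last by right.
left; exists u, (r' :: p2), v, (K ++ x :: L1); split.
  by apply: reduce_swap cf sq mK kx _; exists z.
by rewrite size_cat /= -[X in (X < _)%N]add0n ltn_add2r.
Qed.

Lemma bad_rev v R K r r' m : bad v R K r r' m -> bad v (rev R) (rev K) r' r m.
Proof.
case=> -[p1 [p2 ->]] sq mK; split; last by rewrite mem_rev.
  exists (rev p2), (rev p1); rewrite rev_cat !rev_cons -!cats1 -!catA //.
case: sq => d h; split; first by rewrite diag_sym.
by case: h => -[-> ->]; [right|left].
Qed.

Lemma square_sum u r m r' : square u r m r' ->
  u.1 + m.1 = r.1 + r'.1 /\ u.2 + m.2 = r.2 + r'.2.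
Proof. by case=> _ [[-> ->]|[-> ->]] /=; split; lia. Qed.

(** Suppose the exceptional case occurs at both ends of the chord, [k] and [h] being the last and
    first points of [K]. Then [k] is [u + v - r'] and [h] is [u + v - q'], and in each position
    either [h] is a point of [R] or the end steps of [K] at [u] and [v] cross. *)
Lemma opposite_crossing u v r r' m q q' n k h :
    square u r m r' -> square v q n q' -> opposite u r v -> opposite u m k ->
    opposite v q u -> opposite v n h ->
  h = r' \/ diag u k /\ (corner u k = v /\ corner k u = h \/
                         corner u k = h /\ corner k u = v).
Proof.
move=> sq sq' [o1 o2] [o3 o4] [o5 o6] [o7 o8].
have [e1 e2] := square_sum sq; have [e3 e4] := square_sum sq'.
have ek1 : k.1 = u.1 + v.1 - r'.1 by lia.
have ek2 : k.2 = u.2 + v.2 - r'.2 by lia.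
have eh1 : h.1 = u.1 + v.1 - q'.1 by lia.
have eh2 : h.2 = u.2 + v.2 - q'.2 by lia.
have [er1 er2] : v.1 = u.1 + u.1 - r.1 /\ v.2 = u.2 + u.2 - r.2 by split; lia.
have [/adj1E ur /adj1E ur' _ _] := squareE sq.
have [_ /adj1E vq' _ _] := squareE sq'.
have [d1 d2] := diagE (proj1 sq); have [d3 d4] := diagE (proj1 sq').
move: ek1 ek2 eh1 eh2 er1 er2 ur ur' vq' d1 d2 d3 d4 o5 o6; clear.
case: u v r r' q q' k h => [u1 u2] [v1 v2] [r1 r2] [r'1 r'2] [q1 q2] [q'1 q'2] [k1 k2] [h1 h2].
rewrite /corner /= => -> -> -> -> -> -> ur ur' vq' d1 d2 d3 d4 o5 o6.
case: ur => -[ur [ur2|ur2]]; case: ur' => -[ur' [ur2'|ur2']]; try (exfalso; lia);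
case: vq' => -[vq' [vq2'|vq2']]; try (exfalso; lia);
first [ by left; congr pair; lia
      | by right; split; [apply: diagI => /=; lia|left; split; congr pair; lia]
      | by right; split; [apply: diagI => /=; lia|right; split; congr pair; lia] ].
Qed.

Lemma opposite_both S I u R v K r r' m q q' n : config S I u R v K ->
    bad u R K r r' m -> opposite u r v -> opposite u m (last v K) ->
    bad v (rev R) (rev K) q q' n -> opposite v q u -> opposite v n (last u (rev K)) -> False.
Proof.
case=> -[us ks ps sS] _ _ _ _ br op1 op2 bq op3 op4.
have [_ r'R] := bad_mem br.
case: br bq => _ sq mK [_ sq' _].
case: K us ks ps sS mK op2 op4 => // h K' us ks ps sS mK op2 op4.
have {}op4 : opposite v n h by move: op4; rewrite rev_cons last_rcons.
set s := u :: R ++ v :: h :: K' in us ks ps sS.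
have := sedge_cycle us; rewrite path_arcs /= !rcons_path => /andP[_ /andP[evh /andP[_ eku]]].
rewrite sedge_sym in eku; set k := last h K' in eku op2 *.
have [eh|[duk c]] := opposite_crossing sq sq' op1 op2 op3 op4.
- move: us; rewrite /s cons_uniq cat_uniq => /and3P[_ _ /andP[/hasPn hn _]].
  by have := hn h; rewrite !inE eqxx orbT /= eh r'R => /(_ isT).
- have := ps _ _ _ _ eku evh duk; rewrite /uncrossed /is_edge.
  by case: c => -[-> ->]; rewrite !eqxx ?orbT.
Qed.

(** * Filling a pocket and shrinking the curve *)

Section Finish.
Variables (S : seq Z2) (I O : set Z2) (u v : Z2) (R K : seq Z2).
Hypothesis SIO : sides S I O.
Hypothesis uRvK : config S I u R v K.
Let s := u :: R ++ v :: K.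

Let us : uniq s. Proof. by case: uRvK => [[]]. Qed.
Let ks : cycle king s. Proof. by case: uRvK => [[]]. Qed.
Let sS : s =i S. Proof. by case: uRvK => [[]]. Qed.
Let tuv : tight S u v. Proof. by case: uRvK. Qed.

(* Filling the pocket closed by the chord [u v]: the points of [R] become
   interior, and stay connected to the interior through the corners of the
   diagonal steps of [R]. *)
Lemma fill_pocket Z : cycle king Z -> {subset Z <= S} -> {subset R <= [predC Z]} ->
    (forall a, a \in S -> a \notin Z -> a \in R \/ a = u) ->
    (forall r, r \in R -> winding r Z) ->
    (forall r r' m, ~ bad v (rev R) (rev K) r r' m) ->
    (u \in Z -> forall r r' m, ~ bad u R K r r' m) ->
    (u \notin Z -> exists2 r, r \in R & adj c1 u r) ->
  sides Z (I `|` [set t | (t \in S) && (t \notin Z)]) O.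
Proof.
move=> kZ ZS RZ SZ wZ nbv nbu uadj.
have [_ _ _ wK [z0 z0R [y0 Iy0 ay0]]] := uRvK.
have RS : {subset R <= S} by move=> a ha; rewrite -sS inE mem_cat ha orbT.
set J := I `|` _.
have JR a : a \in R -> J a by move=> ha; right; rewrite /= RS //=; apply: RZ.
have link a b : J a -> J b -> king a b ->
   (diag a b -> J (corner a b) \/ J (corner b a)) -> joined_in c1 J a b.
  move=> Ja Jb /king_cases[->|ab|d] h; first exact: joined_refl.
    exact: joined_adj.
  have h2 c : c = corner a b \/ c = corner b a -> J c -> joined_in c1 J a b.
    move=> hc Jc; have [h1 h3] := corner_adj1 d hc.
    by apply: (@joined_trans _ _ c); apply: joined_adj.
  by case: (h d) => /h2; apply; [left|right].
have uRv : uniq (u :: rcons R v).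
  by move: us; rewrite /s -cat_rcons -cat_cons cat_uniq => /andP[].
have K_C a : a \in K -> a \notin u :: rcons R v.
  move=> ha; apply: contraL us => hb; rewrite /s -cat_rcons -cat_cons cat_uniq.
  by rewrite negb_and orbC negb_and negbK; apply/orP; left; apply/orP; left; apply/hasP; exists a.
have kC : cycle king (u :: rcons R v).
  move: ks; rewrite /s path_arcs => /andP[h _].
  by rewrite /= rcons_path last_rcons h king_sym (tight_king tuv).
have step p1 r r' p2 : R = p1 ++ r :: r' :: p2 -> joined_in c1 J r r'.
  move=> eR; have [rR r'R] : r \in R /\ r' \in R by rewrite eR !mem_cat !inE !eqxx !orbT.
  have krr' : king r r'.
    by move: ks; rewrite /s eR /= -catA rcons_cat cat_path /= => /andP[_ /and3P[]].
  apply: link => [||//|d]; try exact: JR.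
  (* A corner off [S] is not in [O], since it is [c1]-adjacent to [r], around which [Z] winds. *)
  have nout c : c = corner r r' \/ c = corner r' r -> J c \/ c \in Z.
    move=> hc; case: (boolP (c \in S)) => [cS|cS].
      by case: (boolP (c \in Z)) => cZ; [right|left; right; rewrite /= cS].
    have [_ _ cov _ _] := SIO.
    case/cov: (cS) => [Ic|Oc]; first by left; left.
    have [a _] := corner_adj1 d hc.
    have cZ : c \notin Z by apply: contra cS => /ZS.
    have := wZ _ rR; rewrite (winding_adj1 kZ a) //; last exact: RZ.
    by rewrite (sides_winding_out SIO kZ ZS Oc).
  have inK c : c \in Z -> [\/ c = u, c = v | c \in K].
    move=> cZ; have := ZS _ cZ; rewrite -sS inE mem_cat inE => /or4P[/eqP| |/eqP|].
    - by constructor 1.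
    - by move=> /RZ /=; rewrite inE /= cZ.
    - by constructor 2.
    - by constructor 3.
  have [|Z1] := nout (corner r r') (or_introl erefl); first by left.
  have [|Z2'] := nout (corner r' r) (or_intror erefl); first by right.
  exfalso.
  have d' := diag_corner d.
  have cn : corner r r' != corner r' r.
    by apply: contraTneq d' => ->; rewrite /diag eqxx andbF.
  have bu m : u \in Z -> m \in K ->
      u = corner r r' /\ m = corner r' r \/ u = corner r' r /\ m = corner r r' -> False.
    by move=> uZ mK h; apply: (nbu uZ r r' m); split=> //; exists p1, p2.
  have bv m : m \in K ->
      v = corner r r' /\ m = corner r' r \/ v = corner r' r /\ m = corner r r' -> False.
    move=> mK h; apply: (nbv r' r m); apply: bad_rev; split=> //.
    by exists p1, p2.
  have chord : u = corner r r' /\ v = corner r' r \/ v = corner r r' /\ u = corner r' r -> False.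
    move=> h; have [duv er] : diag u v /\ (corner u v = r \/ corner v u = r).
      case: h => -[eu ev]; rewrite eu ev; first by split=> //; left; case: (r).
      by rewrite diag_sym; split=> //; right; case: (r).
    case/orP: tuv => [/adj1_ndiag|/and3P[_ n1 n2]]; first by rewrite duv.
    by case: er => er; [move: n1|move: n2]; rewrite er RS.
  case: (inK _ Z1) => [e1|e1|e1]; case: (inK _ Z2') => [e2|e2|e2].
  - by rewrite e1 e2 eqxx in cn.
  - by apply: chord; left.
  - by apply: (bu _ _ e2); [rewrite -e1|left].
  - by apply: chord; right.
  - by rewrite e1 e2 eqxx in cn.
  - by apply: (bv _ e2); left.
  - by apply: (bu _ _ e1); [rewrite -e2|right].
  - by apply: (bv _ e1); right.
  (* With both corners on [K], the closed pocket has winding 0 around each, yet they lie on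
     different sides of its step from [r] to [r']. *)
  - have := winding_diag kC d (K_C _ e1) (K_C _ e2).
    rewrite !wK // eR rcons_cat !rcons_cons csum_is_edge1 //.
    by move: uRv; rewrite eR rcons_cat.
have conn a b : a \in R -> b \in R -> joined_in c1 J a b.
  case eR : R => [//|x R'].
  have pR : path (fun c d => `[<joined_in c1 J c d>]) x R'.
    apply: consec_path => p1 y p2 eR'; apply/asboolP.
    case/lastP: p1 eR' => [|p1 w] eR'; first by apply: (step [::] _ _ p2); rewrite eR eR'.
    by rewrite last_rcons; apply: (step (x :: p1) _ _ p2); rewrite eR eR' cat_rcons.
  have Jx : J x by apply: JR; rewrite eR mem_head.
  have toall c : c \in x :: R' -> joined_in c1 J x c.
    elim: R' x pR Jx {eR} => [|y R' IH] x /=.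
      by move=> _ Jx; rewrite inE => /eqP->; apply: joined_refl.
    move=> /andP[/asboolP xy pR] Jx; rewrite in_cons => /orP[/eqP->|cy].
      exact: joined_refl.
    have Jy := joined_left (joined_sym xy).
    by apply: joined_trans xy _; apply: IH.
  move=> ha hb; apply: joined_trans (toall _ hb); apply: joined_sym; exact: toall.
have Jy0 : J y0 by left.
have toI a : a \in R -> joined_in c1 J a y0.
  move=> ha; apply: joined_trans (conn _ _ ha z0R) _.
  by apply: joined_adj => //; apply: JR.
apply: sides_extend => //.
- move=> a aS aZ; case: (SZ a aS aZ) => [|ea]; first exact: wZ.
  rewrite ea in aZ *; have [r rR ar] := uadj aZ.
  by rewrite (winding_adj1 kZ ar) ?wZ //; apply: RZ.
- move=> a aS aZ; exists y0 => //; case: (SZ a aS aZ) => [|ea]; first exact: toI.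
  rewrite ea in aS aZ *; have [r rR ar] := uadj aZ.
  apply: joined_trans (toI _ rR); apply: joined_adj => //; last exact: JR.
  by right; rewrite /= aS.
Qed.

End Finish.

Definition shrinks (S : seq Z2) (I O : set Z2) : Prop :=
  exists Z, [/\ uniq Z, cycle king Z, {subset Z <= S}, (size Z < size S)%N &
    sides Z (I `|` [set t | (t \in S) && (t \notin Z)]) O].

Lemma opposite_adj u a b c d : opposite u a b -> opposite u c d -> adj c1 a c -> adj c1 b d.
Proof. by move=> [h1 h2] [h3 h4] /adj1E h; apply: adj1I; lia. Qed.

(** Without bad steps at [u], the new curve is [K] closed by the chord. With one, the last point of
    [K] is [c1]-adjacent to [v], so the corner at [u] can be cut off too; [u] becomes interior
    through its neighbour [r]. *)
Lemma shrink_config S I O u R v K : uniq S -> sides S I O -> config S I u R v K ->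
    (forall r r' m, ~ bad v (rev R) (rev K) r r' m) ->
    (forall r r' m, bad u R K r r' m -> opposite u r v /\ opposite u m (last v K)) ->
  shrinks S I O.
Proof.
move=> uS SIO cf nbv opu.
have [[us ks ps sS] tuv wR wK [z0 z0R _]] := cf.
have sz : size S = (size R + size K).+2.
  have /perm_size<- : perm_eq (u :: R ++ v :: K) S by apply: uniq_perm.
  by rewrite /= size_cat /= addnS.
have R0 : (0 < size R)%N by case: (R) z0R.
have uvK : uniq (u :: v :: K).
  move: us; rewrite [uniq (u :: v :: K)]/= !cons_uniq mem_cat negb_or cat_uniq.
  by move=> /andP[/andP[_ ->] /and3P[_ _]].
have RvK : {subset R <= [predC u :: v :: K]}.
  move=> a aR; rewrite !inE; apply/negP => h; move: us.
  rewrite cons_uniq cat_uniq mem_cat => /andP[/norP[nu _] /and3P[_ /hasPn hn _]].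
  case/orP: h => [/eqP e|h]; first by rewrite -e aR in nu.
  by have := hn a h; rewrite /= aR.
have SuvK a : a \in S -> [\/ a \in R, a = u | a \in v :: K].
  rewrite -sS inE mem_cat => /or3P[/eqP| |]; [constructor 2|constructor 1|constructor 3];
  done.
have subS : {subset u :: v :: K <= S}.
  by move=> a; rewrite -sS !inE mem_cat inE => /or3P[]->; rewrite ?orbT.
have kp : path king v (rcons K u) by move: ks; rewrite path_arcs => /andP[].
have memC a : (a \in v :: rcons K u) = (a \in u :: v :: K).
  by rewrite !inE mem_rcons inE orbCA.
have [[r [r' [m b]]]|nbu] := pselect (exists r r' m, bad u R K r r' m); last first.
  exists (v :: rcons K u).
  have kZ : cycle king (v :: rcons K u).
    by rewrite /= rcons_path kp last_rcons (tight_king tuv).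
  have ZS : {subset v :: rcons K u <= S} by move=> a; rewrite memC => /subS.
  split=> //.
  - by rewrite -rcons_cons -rot1_cons rot_uniq.
  - by rewrite sz /= size_rcons !ltnS -[X in (X < _)%N]add0n ltn_add2r.
  - apply: (fill_pocket SIO cf) => //.
    + by move=> a /RvK; rewrite inE [in X in _ -> X]inE /= memC.
    + move=> a /SuvK[|->|h]; [by left|by right|].
      by rewrite memC inE h orbT.
    + by move=> _ r r' m b; apply: nbu; exists r, r', m.
    + by rewrite memC mem_head.
have [o1 o2] := opu _ _ _ b; have [_ sq mK] := b; have [rR r'R] := bad_mem b.
have [aur aur' amr amr'] := squareE sq.
have kk : adj c1 (last v K) v by apply: opposite_adj o2 o1 amr.
exists (v :: K).
have kpK : path king v K by move: kp; rewrite rcons_path => /andP[].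
have kZ : cycle king (v :: K) by rewrite /= rcons_path kpK adj1_king.
have ZS : {subset v :: K <= S} by move=> a ha; apply: subS; rewrite inE ha orbT.
have uZ : u \notin v :: K by move: uvK; rewrite cons_uniq => /andP[].
split=> //.
- by move: uvK; rewrite cons_uniq => /andP[].
- by rewrite sz /= !ltnS leq_addl.
- apply: (fill_pocket SIO cf) => //.
  + by move=> a /RvK; rewrite inE in_cons negb_or => /andP[_].
  + move=> a /SuvK[|->|h]; [by left|by right|].
    by rewrite h.
  + move=> a aR; have := wR a aR.
    have -> : winding a (v :: rcons K u) =
        winding a (v :: K) (+) winding a [:: last v K; u; v].
      rewrite /winding !csum_cons /= psum_rcons last_rcons (crossC a v (last v K)).
      move: (psum _ v K) (cross a u v) (cross a (last v K) u).
      by move: (cross a (last v K) v) => [] [] [] [].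
    rewrite winding_triangle ?addbF //.
    * by move: kp; rewrite rcons_path => /andP[].
    * exact: tight_king tuv.
    * exact: adj1_king.
    * have := RvK _ aR; rewrite !inE !negb_or => /and3P[nu nv nK].
      rewrite nu nv !andbT; apply: contraNneq nK => ->.
      by case: (K) mK => // y K' _; exact: (mem_last y K').
  + by rewrite (negbTE uZ).
  + by move=> _; exists r.
Qed.

(** Induction on the length of the pocket. If it cannot be reduced, all bad steps are exceptional,
    and by [opposite_both] they occur at one end of the chord at most; reversing the curve makes
    this end [u]. *)
Lemma config_shrinks S I O u R v K :
  uniq S -> sides S I O -> config S I u R v K -> shrinks S I O.
Proof.
move=> uS SIO; have [n] := ubnP (size R); elim: n u R v K => // n IH u R v K hn cf.
have red : reducible S I (size R) -> shrinks S I O.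
  by move=> [u' [R' [v' [K' [cf' h]]]]]; apply: IH cf'; apply: leq_trans h _.
have cf' := config_rev cf.
have [] := pselect (reducible S I (size R)); [exact: red|move=> nred].
have opu r r' m : bad u R K r r' m -> opposite u r v /\ opposite u m (last v K).
  by move=> /(bad_cases SIO cf)[].
have opv r r' m : bad v (rev R) (rev K) r r' m ->
    opposite v r u /\ opposite v m (last u (rev K)).
  by move=> /(bad_cases SIO cf')[]; rewrite ?size_rev.
have [nbv|bv] := pselect (forall r r' m, ~ bad v (rev R) (rev K) r r' m).
  exact: shrink_config cf nbv opu.
apply: (shrink_config uS SIO cf' _ opv) => r r' m; rewrite !revK => b.
apply: bv => q q' q'' b'.
have [o1 o2] := opu _ _ _ b; have [o3 o4] := opv _ _ _ b'.
exact: opposite_both cf b o1 o2 b' o3 o4.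
Qed.

(** * Existence of a chord *)

Lemma telescope_addb (f : nat -> bool) n :
  \big[addb/false]_(0 <= i < n) (f i (+) f i.+1) = f 0%N (+) f n.
Proof.
elim: n => [|n IH]; first by rewrite big_geq // addbb.
by rewrite big_nat_recr //= IH -addbA; congr (_ (+) _); rewrite addbA addbb.
Qed.

Section Potential.
Variables (I : pred Z2) (S : seq Z2) (N : Z2) (phi : Z2 -> bool).
Hypothesis IN : I N.
Hypothesis bd : forall z z', I z -> adj c1 z z' -> ~~ I z' -> z' \in S.
Hypothesis phiE : forall x y, x \in S -> y \in S -> king x y ->
  phi x (+) phi y = cross N x y.

Let side (x y : Z2) : bool := (I x != I y) && phi (if I x then y else x).
(** True far to the left and false far to the right when [I] is bounded, so it changes an odd number
    of times along the row of [N]. *)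
Let col (a : int) : bool := [|| a < N.1, I (a, N.2) | I (a, N.2 + 1)].

(* The sides of the unit squares separating [I] from its complement, weighted
   by the potential of their end point outside of [I]. *)
Lemma square_sides a b :
  side (a, b) (a, b + 1) (+) side (a + 1, b) (a + 1, b + 1)
    (+) (side (a, b) (a + 1, b) (+) side (a, b + 1) (a + 1, b + 1))
  = (b == N.2) && (col a (+) col (a + 1)).
Proof.
have nN x y : ~~ I (x, y) -> x <> N.1 \/ y <> N.2.
  move=> nI; apply: neq_Z2 (x, y) N _; by apply: contraNneq nI => ->.
have inS x y x' y' : I (x, y) -> ~~ I (x', y') ->
    x = x' /\ (y = y' + 1 \/ y' = y + 1) \/ y = y' /\ (x = x' + 1 \/ x' = x + 1) ->
    (x', y') \in S.
  by move=> h h' e; apply: bd h _ h'; apply: adj1I.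
have N00 := nN a b; have N10 := nN (a + 1) b.
have N01 := nN a (b + 1); have N11 := nN (a + 1) (b + 1).
have A1 := inS a b a (b + 1); have A2 := inS a (b + 1) a b.
have A3 := inS a b (a + 1) b; have A4 := inS (a + 1) b a b.
have A5 := inS (a + 1) b (a + 1) (b + 1); have A6 := inS (a + 1) (b + 1) (a + 1) b.
have A7 := inS a (b + 1) (a + 1) (b + 1); have A8 := inS (a + 1) (b + 1) a (b + 1).
have colE : (b == N.2) && (col a (+) col (a + 1)) = (b == N.2) &&
    ([|| a < N.1, I (a, b) | I (a, b + 1)] (+)
     [|| a + 1 < N.1, I (a + 1, b) | I (a + 1, b + 1)]).
  by rewrite /col; case: eqP => [->|].
rewrite colE /side; clear colE inS nN bd.
move: N00 N10 N01 N11 A1 A2 A3 A4 A5 A6 A7 A8.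
case: (I (a, b)); case: (I (a + 1, b)); case: (I (a, b + 1)); case: (I (a + 1, b + 1)) =>
  N00 N10 N01 N11 A1 A2 A3 A4 A5 A6 A7 A8; rewrite /= ?addbF ?addbb ?andbF //.
- by rewrite !orbT /= andbF.
- by rewrite !orbT /= andbF.
- by rewrite !orbT /= andbF.
- rewrite phiE; [|by apply: A1 => //; lia|by apply: A5 => //; lia|by apply/and4P; split => /=; lia].
  by clear; rewrite /cross /=; atoms.
- by rewrite !orbT /= andbF.
- rewrite phiE; [|by apply: A3 => //; lia|by apply: A7 => //; lia|by apply/and4P; split => /=; lia].
  by move: (N10 isT); clear; rewrite /cross /= => ?; atoms.
- by rewrite !orbT /= andbF; case: phi; case: phi.
- rewrite phiE; [|by apply: A1 => //; lia|by apply: A3 => //; lia|by apply/and4P; split => /=; lia].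
  by move: (N10 isT); clear; rewrite /cross /= => ?; atoms.
- by rewrite !orbT /= andbF.
- by rewrite !orbT /= andbF.
- rewrite phiE; [|by apply: A4 => //; lia|by apply: A8 => //; lia|by apply/and4P; split => /=; lia].
  by move: (N00 isT); clear; rewrite /cross /= => ?; atoms.
- rewrite phiE; [|by apply: A5 => //; lia|by apply: A4 => //; lia|by apply/and4P; split => /=; lia].
  by move: (N00 isT); clear; rewrite /cross /= => ?; atoms.
- rewrite phiE; [|by apply: A2 => //; lia|by apply: A6 => //; lia|by apply/and4P; split => /=; lia].
  by clear; rewrite /cross /=; atoms.
- rewrite phiE; [|by apply: A2 => //; lia|by apply: A7 => //; lia|by apply/and4P; split => /=; lia].
  by move: (N00 isT) (N10 isT); clear; rewrite /cross /= => ? ?; atoms.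
- rewrite phiE; [|by apply: A6 => //; lia|by apply: A8 => //; lia|by apply/and4P; split => /=; lia].
  by move: (N00 isT) (N10 isT); clear; rewrite /cross /= => ? ?; atoms.
- by move: (N10 isT); clear => ?; atoms.
Qed.

(** The identity [square_sides] is summed over a large box. On the right the row of [N] telescopes
    to 1. On the left every inner side occurs twice, and the sides on the border of the box vanish
    because [I] does not reach it. *)
Lemma no_potential (r : seq Z2) : (forall z, I z -> z \in r) -> False.
Proof.
move=> Ir; have [B0 hB] := seq_bounded r; pose B := B0.+1.
have IB a b : I (a, b) -> `|a| < B%:Z /\ `|b| < B%:Z by move=> /Ir/hB/=; lia.
pose n := (B + B)%N; pose c (i : nat) : int := i%:Z - B%:Z.
have cS i : c i.+1 = c i + 1 by rewrite /c; lia.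
have c0 : c 0%N = - B%:Z by rewrite /c; lia.
have cn : c n = B%:Z by rewrite /c /n; lia.
have out a b : `|a| = B%:Z \/ `|b| = B%:Z -> I (a, b) = false.
  by move=> h; apply/negbTE/negP => /IB; lia.
have c0o b : I (c 0%N, b) = false by apply: out; left; rewrite c0; lia.
have cno b : I (c n, b) = false by apply: out; left; rewrite cn; lia.
have c0o' a : I (a, c 0%N) = false by apply: out; right; rewrite c0; lia.
have cno' a : I (a, c n) = false by apply: out; right; rewrite cn; lia.
pose V i j := side (c i, c j) (c i, c j + 1).
pose H i j := side (c i, c j) (c i + 1, c j).
have E : \big[addb/false]_(0 <= j < n) \big[addb/false]_(0 <= i < n)
    ((V i j (+) V i.+1 j) (+) (H i j (+) H i j.+1)) = true.
  have [N1 N2] : `|N.1| < B%:Z /\ `|N.2| < B%:Z by apply: IB; rewrite -surjective_pairing.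
  pose j0 := absz (N.2 + B%:Z).
  have jn : (j0 < n)%N by rewrite /j0 /n; lia.
  transitivity (\big[addb/false]_(0 <= j < n) (j == j0)).
    apply: eq_big_nat => j /andP[_ hj].
    rewrite (eq_big_nat _ _ (F2 := fun i => (j == j0) && (col (c i) (+) col (c i.+1)))).
      case: eqP => [ej|_]; last by rewrite big1.
      rewrite telescope_addb /col c0 cn -c0 -cn !c0o !cno c0 cn.
      by case: ltP => h1; case: ltP => h2 //; exfalso; lia.
    move=> i _; rewrite /V /H !cS square_sides; congr (_ && _).
    by apply/eqP/eqP; rewrite /c /j0; lia.
  rewrite (bigD1_seq j0) ?mem_index_iota ?iota_uniq //= eqxx big1 //.
  by move=> j /negbTE.
have : \big[addb/false]_(0 <= j < n) \big[addb/false]_(0 <= i < n)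
    ((V i j (+) V i.+1 j) (+) (H i j (+) H i j.+1)) = false.
  under eq_bigr => j _ do rewrite big_split.
  rewrite big_split /= [X in X (+) _]big1 /=; last first.
    move=> j _; rewrite telescope_addb /V /side.
    by rewrite !c0o !cno.
  rewrite exchange_big /= big1 // => i _; rewrite telescope_addb /H /side.
  by rewrite !c0o' !cno'.
by rewrite E.
Qed.

End Potential.

(** * From a chord around an interior point to a pocket *)

Definition base (S : seq Z2) u R v K : Prop :=
  [/\ [/\ uniq (u :: R ++ v :: K), cycle king (u :: R ++ v :: K),
          planar (u :: R ++ v :: K) & u :: R ++ v :: K =i S] & tight S u v].

Lemma base_swap S u R v K : base S u R v K -> base S v K u R.
Proof.
have e : v :: K ++ u :: R = rot (size R).+1 (u :: R ++ v :: K).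
  by rewrite -cat_cons -[(size R).+1]/(size (u :: R)) rot_size_cat.
case=> -[us ks ps sS] t; split; last by rewrite tight_sym.
rewrite e rot_uniq rot_cycle; split=> //; first exact: planar_rot.
by move=> a; rewrite mem_rot sS.
Qed.

Lemma base_cycle S u R v K : base S u R v K -> clean (u :: R ++ v :: K) (u :: rcons R v).
Proof.
case=> -[us ks ps sS] t; apply: cleanP => //.
  move=> a; rewrite !inE mem_rcons inE mem_cat inE => /or3P[]->; rewrite ?orbT //.
have := sedge_cycle us; rewrite path_arcs => /andP[h _].
rewrite /= rcons_path last_rcons tight_sym (tight_eq _ _ sS) t orbT andbT.
by apply: sub_path h => a b ->.
Qed.

Lemma base_sub S u R v K : base S u R v K -> {subset u :: rcons R v <= S}.
Proof.
case=> -[_ _ _ sS] _ a; rewrite -sS !inE mem_rcons inE mem_cat inE.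
by case/or3P=> ->; rewrite ?orbT.
Qed.

Lemma base_notin S u R v K a : base S u R v K -> a \in K -> a \notin u :: rcons R v.
Proof.
case=> -[us _ _ _] _ ha; apply: contraL us => hb; rewrite -cat_rcons -cat_cons cat_uniq.
rewrite negb_and orbC negb_and negbK; apply/orP; left; apply/orP; left.
by apply/hasP; exists a.
Qed.

Lemma base_const S u R v K : base S u R v K ->
  exists g : bool, {in K, forall z, winding z (u :: rcons R v) = g}.
Proof.
move=> b; have cC := base_cycle b; have nK := fun a => base_notin (a := a) b.
case: (b) => -[us ks ps sS] _.
have := sedge_cycle us; rewrite path_arcs => /andP[_].
case: (K) nK ks cC => [|k K'] nK ks cC /=; first by exists true.
move=> /andP[_]; rewrite rcons_path => /andP[pk _].
exists (winding k (u :: rcons R v)) => z zK.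
by apply: (clean_path ks cC pk) => // a /nK.
Qed.

(** The walk must pass strictly above and strictly below a point that it encloses. *)
Lemma winding_height N (c : seq Z2) : cycle king c -> N \notin c -> winding N c ->
  exists t t', [/\ t \in c, t' \in c & t.2 + 1 < t'.2].
Proof.
move=> kc nc w.
have [t tc ht] : exists2 t, t \in c & t.2 < N.2.
  apply: contrapT => h; have := winding_bottom kc nc; rewrite w.
  suff hs : {in c, forall a : Z2, N.2 <= a.2} by move/(_ hs).
  by move=> a ac; rewrite leNgt; apply/negP => ha; apply: h; exists a.
have [t' tc' ht'] : exists2 t, t \in c & N.2 < t.2.
  apply: contrapT => h; have := @winding_top N c; rewrite w.
  suff hs : {in c, forall a : Z2, a.2 <= N.2} by move/(_ hs).
  by move=> a ac; rewrite leNgt; apply/negP => ha; apply: h; exists a.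
exists t, t'; split=> //; lia.
Qed.

(* A highest or lowest point of [S] is not enclosed by any closed walk on [S]. *)
Lemma base_not_both S u R v K N : base S u R v K -> N \notin S ->
    winding N (u :: rcons R v) ->
    {in K, forall z, winding z (u :: rcons R v)} ->
    {in R, forall z, winding z (v :: rcons K u)} -> False.
Proof.
move=> b NS w hK hR; have b' := base_swap b.
have [kC _] := base_cycle b; have [kC' _] := base_cycle b'.
have cS := base_sub b; have cS' := base_sub b'.
have Nc : N \notin u :: rcons R v by apply: contra NS => /cS.
have [t [t' [tc tc' h]]] := winding_height kC Nc w.
case: (b) => -[us _ _ sS] tuv.
have [z [zS hz] /andP[zu zv]] := outer_point2 (cS _ tc) (cS _ tc') (tight_king tuv) h.
move: (zS); rewrite -sS inE mem_cat inE (negbTE zu) (negbTE zv) /= => /orP[zR|zK].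
  by have := hR z zR; rewrite hz //; apply: base_notin b' zR.
by have := hK z zK; rewrite hz //; apply: base_notin b zK.
Qed.

(** One of the three neighbours of [N] is neither [u] nor [v]. The arc containing it is enclosed by
    the other arc, since [N] is, and by [base_not_both] this does not hold for both arcs. So that
    arc is the pocket. *)
Lemma chord_config S I O u R v K N a1 a2 a3 : sides S I O -> base S u R v K -> I N ->
    uniq [:: a1; a2; a3] -> {subset [:: a1; a2; a3] <= S} ->
    {in [:: a1; a2; a3], forall a, adj c1 a N} ->
    winding N (u :: rcons R v) -> winding N (v :: rcons K u) ->
  exists u' R' v' K', config S I u' R' v' K'.
Proof.
move=> SIO b IN ua aS aN w w'; have b' := base_swap b.
have NS : N \notin S by case: SIO => _ _ cov _ _; apply/cov; left.
have [kC _] := base_cycle b; have [kC' _] := base_cycle b'.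
have cS := base_sub b; have cS' := base_sub b'.
have Nc : N \notin u :: rcons R v by apply: contra NS => /cS.
have Nc' : N \notin v :: rcons K u by apply: contra NS => /cS'.
have [g hg] := base_const b; have [g' hg'] := base_const b'.
have [a ha auv] : exists2 a, a \in [:: a1; a2; a3] & (a != u) && (a != v).
  have [//|] := pselect (exists2 a, a \in [:: a1; a2; a3] & (a != u) && (a != v)).
  move=> h; have sub : {subset [:: a1; a2; a3] <= [:: u; v]}.
    move=> a ha; rewrite !inE -[_ || _]negbK negb_or; apply/negP => n; apply: h.
    by exists a.
  by have := uniq_leq_size ua sub.
have aK : a \in K -> g by move=> /[dup] /hg <- /(base_notin b) n;
  rewrite (winding_adj1 kC (aN _ ha)).
have aR : a \in R -> g' by move=> /[dup] /hg' <- /(base_notin b') n;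
  rewrite (winding_adj1 kC' (aN _ ha)).
case: (b) => -[us ks ps sS] tuv.
have aRK : a \in R \/ a \in K.
  have := aS _ ha; rewrite -sS inE mem_cat inE; case/andP: auv => /negbTE-> /negbTE-> /=.
  by move/orP.
have hyp : exists2 y, I y & adj c1 a y by exists N => //; exact: aN.
case eg : g hg aK => hg aK; case eg' : g' hg' aR => hg' aR.
- exfalso; exact: base_not_both b NS w hg hg'.
- exists v, K, u, R; case: b' => [hb' tb']; split=> //; exists a => //.
  by case: aRK => // /aR.
- exists u, R, v, K; split=> //; exists a => //.
  by case: aRK => // /aK.
- by case: aRK => [/aR|/aK].
Qed.

Section Chord.
Variables (S : seq Z2) (I O : set Z2) (N : Z2).
Hypothesis SIO : sides S I O.
Hypothesis IN : I N.
Hypothesis uS : uniq S.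

Let f := cross N.

(** Crossings with the ray from [N] along [S] from its first point up to [x]; [behead] removes the
    starting point, which [psum] takes separately. *)
Definition potential (x : Z2) : bool :=
  psum f (head x S) (behead (rcons (take (index x S) S) x)).

Lemma potential_cat A u R v B : S = A ++ u :: R ++ v :: B ->
  potential u (+) potential v = psum f u (rcons R v).
Proof.
move=> eS.
have uS' : uniq (A ++ u :: R ++ v :: B) by rewrite -eS.
have iu : take (index u S) S = A.
  rewrite eS index_cat; have -> : u \in A = false.
    apply/negbTE; move: uS'; rewrite cat_uniq => /and3P[_ /hasPn h _].
    by apply: h; apply: mem_head.
  by rewrite /= eqxx addn0 take_size_cat.
have iv : take (index v S) S = A ++ u :: R.
  have eS2 : S = (A ++ u :: R) ++ v :: B by rewrite eS -catA.
  rewrite {1 2}eS2 index_cat; have -> : v \in A ++ u :: R = false.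
    apply/negbTE; move: uS; rewrite eS2 cat_uniq => /and3P[_ /hasPn h _].
    by apply: h; apply: mem_head.
  by rewrite /= eqxx addn0 take_size_cat.
rewrite /potential iu iv eS; case: A {uS' iu iv eS} => [|a A] //=.
rewrite rcons_cat psum_cat [psum f a (rcons A u)]psum_rcons /=.
by case: (psum f a A); case: (f _ u); case: psum.
Qed.

(** Otherwise [potential] would change along every tight chord by its crossing with the ray. For a
    diagonal pair that is not tight, the same follows by passing through a corner on [S]. This
    contradicts [no_potential]. *)
Lemma exists_chord :
  exists u R v K n, [/\ rot n S = u :: R ++ v :: K, tight S u v &
    winding N (u :: rcons R v)].
Proof.
apply: contrapT => nex; have [[finI infO] _ cov [jI jO] na] := SIO.
have tp x y : x \in S -> y \in S -> tight S x y -> potential x (+) potential y = f x y.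
  have H A u R v B : S = A ++ u :: R ++ v :: B -> tight S u v ->
      potential u (+) potential v = f u v.
    move=> eS t; rewrite (potential_cat eS).
    have := nex; apply: contra_notP => ne; exists u, R, v, (B ++ A), (size A).
    split=> //; first by rewrite eS rot_size_cat /= -catA.
    rewrite /winding csum_cons last_rcons crossC -/f.
    by case: psum ne; case: f.
  move=> xS yS t; have nxy : y != x.
    case/orP: t => [/adj1_neq|/and3P[/and3P[_ h _] _ _]]; first by rewrite eq_sym.
    by apply: contraNneq h => ->.
  have [A [q eS]] : exists A q, S = A ++ x :: q by case/splitPr: xS => A q; exists A, q.
  move: yS; rewrite eS mem_cat inE (negbTE nxy) /= => /orP[] yS.
    have [A1 [A2 eA]] : exists A1 A2, A = A1 ++ y :: A2.
      by case/splitPr: yS => A1 A2; exists A1, A2.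
    rewrite addbC /f crossC; apply: (H A1 y A2 x q); last by rewrite tight_sym.
    by rewrite eS eA -catA.
  have [A1 [A2 eA]] : exists A1 A2, q = A1 ++ y :: A2.
    by case/splitPr: yS => A1 A2; exists A1, A2.
  by apply: (H A x A1 y A2); rewrite // eS eA.
have fxx x : f x x = false.
  by rewrite /f /cross; case: eqP => //= ->; case: eqP => //=; lia.
pose inI z := `[< I z >].
have NS : N \notin S by apply/cov; left.
have /finite_seqP[r er] := finI.
apply: (@no_potential inI S N potential _ _ _ r).
- exact/asboolP.
- move=> z z' /asboolP Iz a nz'; apply: contraT => /cov[Iz'|Oz'].
    by move/negP: nz' => []; apply/asboolP.
  by have := na _ _ Iz Oz'; rewrite a.
- move=> x y xS yS /king_cases[->|a|d]; first by rewrite addbb -/f fxx.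
    by apply: tp; rewrite // /tight a.
  case: (boolP (tight S x y)) => [|nt]; first exact: tp.
  have [m [mS am]] : exists m, m \in S /\ (adj c1 x m /\ adj c1 m y).
    move: nt; rewrite /tight d negb_or /= negb_and !negbK => /andP[_ /orP[]h].
      by exists (corner x y); split=> //; apply: corner_adj1; [|left].
    by exists (corner y x); split=> //; apply: corner_adj1; [|right].
  have tri := @cross_triangle N x m y (adj1_king am.1) (adj1_king am.2) (diag_king d)
     (mem_neq NS xS) (mem_neq NS mS) (mem_neq NS yS).
  have e1 := tp _ _ xS mS; have e2 := tp _ _ mS yS.
  move: tri; rewrite -[cross N x m]e1 ?/tight ?am.1 // -[cross N m y]e2 ?/tight ?am.2 //.
  rewrite (crossC N y x).
  by case: (potential x); case: (potential m); case: (potential y); case: cross.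
- by move=> z /asboolP; rewrite er.
Qed.

End Chord.

(** * Uncrossing a curve *)

Fixpoint diag_count (x : Z2) (p : seq Z2) : nat :=
  if p is y :: p' then diag x y + diag_count y p' else 0.

Definition diag_cycle (c : seq Z2) : nat :=
  if c is x :: p then diag_count x (rcons p x) else 0.

Lemma diag_count_cat x p q :
  diag_count x (p ++ q) = (diag_count x p + diag_count (last x p) q)%N.
Proof. by elim: p x => //= y p IH x; rewrite IH addnA. Qed.

Lemma diag_count_rcons x p y :
  diag_count x (rcons p y) = (diag_count x p + diag (last x p) y)%N.
Proof. by rewrite -cats1 diag_count_cat /= addn0. Qed.

Lemma diag_count_rev x p : diag_count (last x p) (rev (belast x p)) = diag_count x p.
Proof.
elim: p x => //= y p IH x; rewrite rev_cons diag_count_rcons IH addnC diag_sym.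
by case: p {IH} => [|z p] //=; rewrite rev_cons last_rcons.
Qed.

Lemma diag_cycle_rot n c : diag_cycle (rot n c) = diag_cycle c.
Proof.
rewrite /rot -{3}(cat_take_drop n c).
case: (take n c) (drop n c) => [|x p] [|y q]; rewrite ?cats0 //= !rcons_cat !diag_count_cat /=.
by rewrite !diag_count_rcons; lia.
Qed.

Lemma next_last (x : Z2) p : uniq (x :: p) -> next (x :: p) (last x p) = x.
Proof.
move=> us; have := cycle_next us.
by rewrite /= rcons_path => /andP[_ /eqP].
Qed.

Lemma next_cat (p : seq Z2) x y q : uniq (p ++ x :: y :: q) -> next (p ++ x :: y :: q) x = y.
Proof.
move=> us; have := cycle_next us; case: p us => [|z p] us /=; first by case/andP=> /eqP.
by rewrite rcons_cat cat_path /= => /andP[_ /and3P[_ /eqP]].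
Qed.

(** Reversing the part of the curve between two crossing diagonals replaces them by two sides of
    their square, with the same points and fewer diagonal steps. *)
Lemma two_opt s a b : uniq s -> cycle king s -> a \in s -> b \in s ->
    diag a (next s a) ->
    is_edge (corner a (next s a)) (corner (next s a) a) b (next s b) ->
  exists t, [/\ uniq t /\ cycle king t, t =i s, (diag_cycle t < diag_cycle s)%N &
    forall x y, sedge s x y ->
      [|| sedge t x y, is_edge a (next s a) x y | is_edge b (next s b) x y]].
Proof.
move=> us ks ha hb; set c := next s a; set d := next s b => dac hbd.
have cs : c \in s by rewrite mem_next.
have [n p es] := rot_to cs.
have us1 : uniq (c :: p) by rewrite -es rot_uniq.
have ns1 : next (c :: p) =1 next s by move=> x; rewrite -es next_rot.
have ela : last c p = a.
  apply: (can_inj (prev_next us)); rewrite -ns1 next_last //.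
have bac : b <> a.
  move=> e; move/and3P: dac => [_ /eqP n1 /eqP n2].
  case/is_edgeE: hbd => -[eb _]; rewrite e in eb.
    by apply: n2; rewrite [in LHS]eb.
  by apply: n1; rewrite [in LHS]eb.
have [A [q eAq]] : exists A q, c :: p = rcons A b ++ d :: q.
  have bs : b \in c :: p by rewrite -es mem_rot.
  have [A [q eq1]] : exists A q, c :: p = A ++ b :: q.
    by case/splitPr: bs => A q; exists A, q.
  case: q eq1 => [|d' q] eq1.
    by exfalso; apply: bac; rewrite -ela -[last c p]/(last c (c :: p)) eq1 last_cat.
  exists A, q; rewrite cat_rcons eq1; congr (_ ++ _ :: _ :: _).
  by rewrite /d -ns1 eq1 next_cat // -eq1.
have [p1 eA] : exists p1, rcons A b = c :: p1.
  by case: A eAq => [|z A] [ez _]; [exists [::]|exists (rcons A b)]; rewrite ez.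
have el : last c p1 = b by rewrite -[last c p1]/(last c (c :: p1)) -eA last_rcons.
have ep : p = p1 ++ d :: q by move: eAq; rewrite eA => -[].
pose l2 := rev (belast c p1).
have eb2 : rev (c :: p1) = b :: l2 by rewrite lastI rev_rcons el.
have el2 : last b l2 = c by rewrite -[last b l2]/(last b (b :: l2)) -eb2 rev_cons last_rcons.
have ea : last d q = a by rewrite -ela ep last_cat.
pose t := b :: l2 ++ d :: q.
have ets : perm_eq t (c :: p).
  have h : perm_eq (rev (c :: p1) ++ d :: q) ((c :: p1) ++ d :: q).
    by rewrite perm_cat2r perm_rev.
  by rewrite ep; rewrite eb2 in h.
have [acd aab] : adj c1 c d /\ adj c1 a b.
  by move/is_edgeE: hbd => [[eb ed]|[eb ed]]; split;
    [rewrite adj1_sym; apply: (corner_adj1 dac _).2|apply: (corner_adj1 dac _).1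
    |rewrite adj1_sym; apply: (corner_adj1 dac _).2|apply: (corner_adj1 dac _).1];
    rewrite ?eb ?ed; by [left|right].
have pathE (e : rel Z2) : symmetric e -> cycle e (c :: p) =
    [&& path e b l2, e b d, path e d q & e a c].
  move=> se; rewrite ep /= rcons_cat cat_path /= rcons_path el ea.
  have h := rev_path e c p1; rewrite el -/l2 in h; rewrite h.
  by congr (_ && _); apply: eq_path => x y; exact: se.
have cycE (e : rel Z2) : cycle e t = [&& path e b l2, e c d, path e d q & e a b].
  by rewrite /t /= rcons_cat cat_path /= rcons_path el2 ea.
have ut : uniq t by rewrite (perm_uniq ets).
exists t; split.
- split=> //; rewrite cycE (adj1_king acd) (adj1_king aab) andbT.
  have : cycle king (c :: p) by rewrite -es rot_cycle.
  by rewrite pathE; [case/and4P=> -> _ ->|exact: king_sym].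
- by move=> x; rewrite (perm_mem ets) -es mem_rot.
- rewrite -(diag_cycle_rot n s) es /t ep /= !rcons_cat !diag_count_cat /= !diag_count_rcons.
  rewrite el2 ea el (negbTE (adj1_ndiag acd)) (negbTE (adj1_ndiag aab)) dac.
  have h := diag_count_rev c p1; rewrite el -/l2 in h; rewrite h.
  by move: (diag_count c p1) (diag_count d q) (diag b d) => m k f; clear; lia.
- pose e x y := [|| sedge t x y, is_edge a c x y | is_edge b d x y].
  have se : symmetric e by move=> x y; rewrite /e sedge_sym !(is_edgeC _ _ x y).
  move=> x0 y0; apply: (@sedgeP e s _ _ _ se); rewrite -(rot_cycle n) es pathE //.
  have := sedge_cycle ut; rewrite cycE => /and4P[h1 h2 h3 h4].
  rewrite /e /is_edge !eqxx !orbT /= andbT; apply/andP; split.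
    by apply: sub_path h1 => x y ->.
  by apply: sub_path h3 => x y ->.
Qed.

(** Induction on the number of diagonal steps. A diagonal step with a corner off the curve is never
    crossed, hence never removed, because the set of points does not change. *)
Lemma uncross s : uniq s -> cycle king s -> exists t,
  [/\ uniq t, cycle king t, planar t, t =i s &
    forall x y, sedge s x y ->
      (diag x y -> ~~ ((corner x y \in s) && (corner y x \in s))) -> sedge t x y].
Proof.
have [n] := ubnP (diag_cycle s); elim: n s => // n IH s hn us ks.
have [ps|nps] := pselect (planar s); first by exists s.
have [x [y [a [b [exy eab dxy cr]]]]] : exists x y a b,
    [/\ sedge s x y, sedge s a b, diag x y & is_edge (corner x y) (corner y x) a b].
  apply: contrapT => nex; apply: nps => x y a b h1 h2 d.
  by apply/negP => h; apply: nex; exists x, y, a, b.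
have {exy dxy cr} [x' [xs' dx' cr']] : exists x', [/\ x' \in s, diag x' (next s x') &
    is_edge (corner x' (next s x')) (corner (next s x') x') a b].
  case/and3P: exy => xs ys /orP[/eqP e|/eqP e].
    by exists x; rewrite e.
  by exists y; rewrite e diag_sym is_edge_sym.
have {eab cr'} [b' [bs' cr]] : exists b', b' \in s /\
    is_edge (corner x' (next s x')) (corner (next s x') x') b' (next s b').
  case/and3P: eab => as' bs' /orP[/eqP e|/eqP e].
    by exists a; rewrite e.
  by exists b; rewrite e is_edgeC.
have [t [[ut kt] ts lt ht]] := two_opt us ks xs' bs' dx' cr.
have [t' [ut' kt' pt' ts' ht']] := IH t (leq_trans lt hn) ut kt.
exists t'; split=> //; first by move=> z; rewrite ts' ts.
move=> z w ezw nzw; apply: ht'; last by rewrite !ts.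
have ns z' : z' \in s -> next s z' \in s by rewrite mem_next.
case/or3P: (ht z w ezw) => // h; exfalso.
  have /is_edgeE cr2 := cr.
  have dzw : diag z w by case/is_edgeE: h => -[-> ->] //; rewrite diag_sym.
  move: (nzw dzw); apply/negP; rewrite negbK.
  by case/is_edgeE: h => -[-> ->]; case: cr2 => -[<- <-]; rewrite bs' ns.
have h2 : diag b' (next s b') by apply: crossed_diag dx' _; rewrite negbK.
have dzw : diag z w by case/is_edgeE: h => -[-> ->] //; rewrite diag_sym.
move: (nzw dzw); apply/negP; rewrite negbK.
have ce (p q : Z2) : corner (corner p q) (corner q p) = p by case: p.
case/is_edgeE: h => -[-> ->]; case/is_edgeE: cr => -[-> ->];
  by rewrite !ce xs' ns.
Qed.

Lemma star_next (s : seq Z2) p a b : uniq s -> p \in s -> next s p = a -> next s b = p ->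
    b \in s -> a != b -> p != a ->
  exists q n, rot n s = p :: a :: q /\ last a q = b.
Proof.
move=> us ps na nb bs nab npa; have [n l e] := rot_to ps.
have ul : uniq (p :: l) by rewrite -e rot_uniq.
have nx : next (p :: l) =1 next s by move=> x; rewrite -e next_rot.
case: l e ul nx => [|a' q] e ul nx.
  by move: npa; rewrite -na -nx /= eqxx; case: eqP.
have ea : a' = a by rewrite -na -nx /= eqxx.
subst a'; exists q, n; split=> //.
apply: (can_inj (prev_next us)); rewrite nb -nx.
exact: (next_last ul).
Qed.

Lemma star_list (s : seq Z2) p a b : uniq s -> cycle king s -> sedge s p a -> sedge s p b ->
    a != b -> p != a -> p != b ->
  exists q, [/\ uniq (p :: a :: q), cycle king (p :: a :: q), p :: a :: q =i s,
    last a q = b & planar s -> planar (p :: a :: q)].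
Proof.
move=> us ks ea eb nab npa npb.
have [ps as'] := sedge_mem ea; have [_ bs] := sedge_mem eb.
have main t : uniq t -> cycle king t -> t =i s -> (planar s -> planar t) ->
    next t p = a -> next t b = p -> exists q, [/\ uniq (p :: a :: q),
      cycle king (p :: a :: q), p :: a :: q =i s, last a q = b &
      planar s -> planar (p :: a :: q)].
  move=> ut kt ts pt na nb.
  have pt' : p \in t by rewrite ts.
  have bt : b \in t by rewrite ts.
  have [q [n [e el]]] := star_next ut pt' na nb bt nab npa.
  exists q; rewrite -e rot_uniq rot_cycle; split=> //.
    by move=> x; rewrite mem_rot ts.
  by move=> /pt; apply: planar_rot.
case/and3P: ea => _ _ /orP[/eqP na|/eqP na].
  apply: (main s) => //; case/and3P: eb => _ _ /orP[/eqP nb|/eqP //].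
  by move: nab; rewrite -na nb eqxx.
apply: (main (rev s)) => //.
- by rewrite rev_uniq.
- by rewrite rev_cycle; apply: sub_cycle ks => x y; rewrite king_sym.
- by move=> x; rewrite mem_rev.
- exact: planar_rev.
- by rewrite next_rev // -na prev_next.
- case/and3P: eb => _ _ /orP[/eqP nb|/eqP nb].
    by rewrite next_rev // -nb prev_next.
  by move: nab; rewrite -(prev_next us a) -(prev_next us b) na nb eqxx.
Qed.

(** * The neighbours of a thick vertex *)

Lemma sides_eq S S' I O : S =i S' -> sides S I O -> sides S' I O.
Proof.
move=> e [h1 h2 cov [jI jO] na]; have e' : [set` S'] = [set` S].
  by apply/seteqP; split=> x /=; rewrite e.
by split=> //; [move=> z; rewrite -e|rewrite e'].
Qed.

Lemma shrinks_eq S S' I O : uniq S -> uniq S' -> S =i S' -> shrinks S I O -> shrinks S' I O.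
Proof.
move=> uS uS' e [Z [uZ kZ ZS sz h]]; exists Z; split=> //.
- by move=> x /ZS; rewrite e.
- by rewrite -(perm_size (uniq_perm uS uS' e)).
- have -> // : [set t | (t \in S') && (t \notin Z)] = [set t | (t \in S) && (t \notin Z)].
  by apply/seteqP; split=> x /=; rewrite e.
Qed.

Lemma winding_rotn z n c : winding z (rot n c) = winding z c.
Proof. by rewrite /rot winding_rot cat_take_drop. Qed.

(** Cases on which arcs of [S] between [p] and [E], closed by the chord, enclose [N]. Both is
    impossible. If only the arc through [a] does, the chord from [E] to [a] gives a pocket
    containing [p]; if only the other does, the chord from [p] to [E] gives one containing [a]. If
    neither does, [S] has winding 0 around [N], so both arcs of the chord from [exists_chord]
    enclose [N]. *)
Lemma star_shrinks p a q I O N E : let S := p :: a :: q in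
    uniq S -> cycle king S -> planar S -> sides S I O -> I N ->
    a != last a q -> square p E a N -> adj c1 (last a q) N -> E \in S ->
  shrinks S I O.
Proof.
move=> S uS kS pS SIO IN nab sq bN ES; set b := last a q in nab bN.
have [apE apN aaE aaN] := squareE sq.
have NS : N \notin S by case: SIO => _ _ cov _ _; apply/cov; left.
have dEN : diag E N by case: sq.
have Eb : E != b by apply: contraTneq dEN => ->; exact: adj1_ndiag.
have pE := adj1_neq apE; have aE := adj1_neq aaE.
have Eq : E \in q by move: ES; rewrite !inE ![E == _]eq_sym (negbTE pE) (negbTE aE).
have [q1 [K eq]] : exists q1 K, q = q1 ++ E :: K by case/splitPr: Eq => q1 K; exists q1, K.
have bK : b \in K.
  move: Eb; rewrite /b eq last_cat /=; case: (K) => [|k K'] /=; first by rewrite eqxx.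
  by move=> _; exact: (mem_last k K').
have eS : S = p :: (a :: q1) ++ E :: K by rewrite /S eq.
have tpE : tight S p E by rewrite /tight apE.
have B : base S p (a :: q1) E K by split; rewrite // -?eS.
have B' := base_swap B.
have [kC' _] := base_cycle B; have [kC _] := base_cycle B'.
have cS' := base_sub B; have cS := base_sub B'.
have Nc' : N \notin p :: rcons (a :: q1) E by apply: contra NS => /cS'.
have Nc : N \notin E :: rcons K p by apply: contra NS => /cS.
have [g hg] := base_const B; have [g' hg'] := base_const B'.
have aL : a \in a :: q1 by apply: mem_head.
have eg : winding N (p :: rcons (a :: q1) E) = g.
  by rewrite -(hg _ bK) (winding_adj1 kC' bN) // (base_notin B bK).
have eg' : winding N (E :: rcons K p) = g'.
  by rewrite -(hg' _ aL) (winding_adj1 kC aaN) // (base_notin B' aL).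
have aS : a \in S by rewrite !inE eqxx orbT.
have pS' : p \in S by rewrite inE eqxx.
have bS : b \in S by rewrite /S inE mem_last orbT.
have b_p : b != p by apply: contraTneq uS => e; rewrite cons_uniq -e mem_last.
have a_p : a != p by apply: contraTneq uS => e; rewrite cons_uniq -e mem_head.
case Eg : g eg hg => eg hg; case Eg' : g' eg' hg' => eg' hg'.
- exfalso; exact: base_not_both B NS eg hg hg'.
- have uS1 : rot 1 S = a :: q1 ++ E :: rcons K p.
    by rewrite eS rot1_cons /= rcons_cat.
  have eR : rot (size q1).+1 (rot 1 S) = E :: (K ++ [:: p]) ++ a :: q1.
    rewrite uS1 -cat_cons -[(size q1).+1]/(size (a :: q1)) rot_size_cat.
    by rewrite -cats1.
  have tri z : z \notin [:: p; a; E] -> winding z [:: p; a; E] = false.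
    apply: winding_triangle; [by case/andP: kS|by rewrite adj1_king|exact: adj1_king].
  have w1 z : z \notin [:: p; a; E] ->
      winding z (a :: rcons q1 E) = winding z (p :: rcons (a :: q1) E).
    move=> /tri tz; rewrite -[RHS]addbF -tz /winding /= !psum_rcons /= !last_rcons.
    rewrite (crossC z a E); move: (cross z p a) (psum _ a q1) (cross z _ E) (cross z E a).
    by move: (cross z E p) => [] [] [] [] [].
  have w2 z : z \notin [:: p; a; E] ->
      winding z (E :: rcons (K ++ [:: p]) a) = winding z (E :: rcons K p).
    move=> /tri tz; rewrite -[RHS]addbF -tz cats1 /winding /= !psum_rcons !last_rcons /=.
    rewrite (crossC z E p); move: (cross z p a) (psum _ E K) (cross z _ p) (cross z a E).
    by move: (cross z p E) => [] [] [] [] [].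
  have Ntri : N \notin [:: p; a; E].
    rewrite !inE !negb_or; apply/and3P; split.
    - by rewrite eq_sym; exact: adj1_neq apN.
    - by rewrite eq_sym; exact: adj1_neq aaN.
    - by apply: contraTneq dEN => ->; rewrite /diag eqxx andbF.
  apply: (config_shrinks uS SIO (u := E) (R := K ++ [:: p]) (v := a) (K := q1)).
  split.
  + split; rewrite -eR ?rot_uniq ?rot_cycle //.
      by apply: planar_rot; [rewrite rot_uniq|apply: planar_rot].
    by move=> x; rewrite !mem_rot.
  + by rewrite /tight adj1_sym aaE.
  + move=> z; rewrite mem_cat inE => /orP[zK|/eqP->].
      rewrite w1 ?hg //; have := base_notin B zK.
      by rewrite !inE mem_rcons !inE !negb_or => /and4P[-> -> -> _].
    have pn : p \notin a :: rcons q1 E.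
      by have := uS; rewrite eS cons_uniq -cat_rcons mem_cat negb_or => /andP[/andP[]].
    have Nn : N \notin a :: rcons q1 E.
      by apply: contra Nc' => h; rewrite inE h orbT.
    rewrite (winding_adj1 _ apN) ?w1 //.
    move: kC'; rewrite /= !rcons_path => /and3P[_ h _].
    by rewrite h last_rcons king_sym adj1_king.
  + move=> z zq; rewrite w2 ?hg' // ?inE ?zq ?orbT //.
    have /(base_notin B') : z \in a :: q1 by rewrite inE zq orbT.
    rewrite !inE mem_rcons !inE !negb_or => /and3P[-> -> _]; rewrite andbT /=.
    apply: contraTneq uS => ez; rewrite eS /= -ez.
    by rewrite (mem_cat z) zq !andbF.
  + by exists p; [rewrite mem_cat mem_head orbT|exists N].
- apply: (config_shrinks uS SIO (u := p) (R := a :: q1) (v := E) (K := K)).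
  by case: B => hB _; split=> //; exists a => //; exists N.
- have [u [R [v [K' [n [eR tuv w]]]]]] := exists_chord SIO IN uS.
  have bB : base S u R v K'.
    split=> //; rewrite -eR rot_uniq rot_cycle; split=> //; first exact: planar_rot.
    by move=> x; rewrite mem_rot.
  have wS : winding N S = false.
    have : winding N S = winding N (p :: rcons (a :: q1) E) (+) winding N (E :: rcons K p).
      rewrite /winding eS !csum_cons !last_rcons !psum_rcons psum_cat last_cat /=.
      rewrite (crossC N p E); move: (cross N p a) (psum _ a q1) (cross N E p).
      by move: (cross N (last a q1) E) (psum _ E K) (cross N _ p) => [] [] [] [] [] [].
    by rewrite eg eg'.
  have w' : winding N (v :: rcons K' u).
    have : winding N S = winding N (u :: rcons R v) (+) winding N (v :: rcons K' u).
      rewrite -(winding_rotn N n) eR /winding !csum_cons !last_rcons !psum_rcons.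
      rewrite psum_cat last_cat /= (crossC N u v).
      move: (psum _ u R) (psum _ v K') (cross N v u) (cross N (last u R) v).
      by move: (cross N _ u) => [] [] [] [] [].
    by rewrite wS w; case: winding.
  have u3 : uniq [:: p; a; b].
    by rewrite /= !inE !negb_or andbT nab ![p == _]eq_sym a_p b_p.
  have S3 : {subset [:: p; a; b] <= S}.
    by move=> z; rewrite [z \in [:: _; _; _]]inE !in_cons orbF => /or3P[]/eqP->.
  have N3 : {in [:: p; a; b], forall z, adj c1 z N}.
    by move=> z; rewrite !inE => /or3P[]/eqP->.
  have [u' [R' [v' [K'' cf]]]] := chord_config SIO bB IN u3 S3 N3 w w'.
  exact: config_shrinks uS SIO cf.
Qed.

Lemma square_corners u r m r' : square u r m r' ->
  diag u m /\ (corner u m = r /\ corner m u = r' \/ corner u m = r' /\ corner m u = r).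
Proof.
case=> d [[-> ->]|[-> ->]]; split; try exact: diag_corner.
- by left; case: (r) (r') => [? ?] [? ?].
- by rewrite diag_sym; exact: diag_corner.
- by right; case: (r) (r') => [? ?] [? ?].
Qed.

(** Uncrossing provides planarity, and the steps at [p] survive it because their corner [N] is not
    on [S]. *)
Lemma neighbour_shrinks S I O p a b N E W : uniq S -> cycle king S -> sides S I O ->
    I N -> sedge S p a -> sedge S p b -> a != b ->
    square p E a N -> square p W b N -> E \in S ->
  shrinks S I O.
Proof.
move=> uS kS SIO IN ea eb nab sq sq' ES.
have NS : N \notin S by case: SIO => _ _ cov _ _; apply/cov; left.
have off r c : square p r c N -> diag p c -> ~~ ((corner p c \in S) && (corner c p \in S)).
  move=> /square_corners[_ [[_ e]|[e _]]] _; apply: contra NS => /andP[];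
  by rewrite e.
have [t [ut kt pt tS ht]] := uncross uS kS.
have eta := ht _ _ ea (off _ _ sq); have etb := ht _ _ eb (off _ _ sq').
have [dpa _] := square_corners sq; have [dpb _] := square_corners sq'.
have dneq x y : diag x y -> x != y.
  by case/and3P=> _ n _; apply: contraNneq n => ->.
have [q [uq kq qt lq pq]] := star_list ut kt eta etb nab (dneq _ _ dpa) (dneq _ _ dpb).
have qS : p :: a :: q =i S by move=> x; rewrite qt tS.
have Sq : S =i p :: a :: q by move=> x; rewrite qS.
apply: (shrinks_eq uq uS qS); apply: (star_shrinks uq kq (pq pt) (sides_eq Sq SIO) IN _ sq).
- by rewrite lq.
- by rewrite lq; have [] := squareE sq'.
- by rewrite qS.
Qed.

Definition ring_step (i k : nat) : bool := ((k == (i + 1) %% 8) || (k == (i + 7) %% 8))%N.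

Lemma ring_stepP u i k : (i < 8)%N -> (k < 8)%N -> ring_step i k ->
  adj c1 (ring_pt u i) (ring_pt u k).
Proof.
move=> i8 k8 h; apply: adj1I; move: h; rewrite /ring_pt /=.
by move: i8 k8; do 8?[case: i => [|i] //]; do 8?[case: k => [|k] //]; move=> _ _ //= _; lia.
Qed.

(** The directions [i], [l], [j], [l'], [i'] of [E], [a], [N], [b], [W] are consecutive. Of the
    other three, the outer two are next to [E] and [W], and the middle one is next to the one beside
    [E]. *)
Lemma ring_star i l i' l' j k : i \in iota 0 8 -> l \in iota 0 8 -> i' \in iota 0 8 ->
    l' \in iota 0 8 -> j \in iota 0 8 -> k \in iota 0 8 -> l != l' ->
    ((l == (i + 1) %% 8) && (j == (i + 2) %% 8)
      || (l == (i + 7) %% 8) && (j == (i + 6) %% 8))%N ->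
    ((l' == (i' + 1) %% 8) && (j == (i' + 2) %% 8)
      || (l' == (i' + 7) %% 8) && (j == (i' + 6) %% 8))%N ->
  [|| k \in [:: j; l; l'; i; i'], ring_step i k, ring_step i' k |
      has (fun f => [&& f \notin [:: j; l; l'; i; i'], ring_step i f & ring_step f k])
          (iota 0 8)].
Proof.
pose P i l i' l' j k := [==> l != l',
    ((l == (i + 1) %% 8) && (j == (i + 2) %% 8)
      || (l == (i + 7) %% 8) && (j == (i + 6) %% 8))%N,
    ((l' == (i' + 1) %% 8) && (j == (i' + 2) %% 8)
      || (l' == (i' + 7) %% 8) && (j == (i' + 6) %% 8))%N =>
  [|| k \in [:: j; l; l'; i; i'], ring_step i k, ring_step i' k |
      has (fun f => [&& f \notin [:: j; l; l'; i; i'], ring_step i f & ring_step f k])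
          (iota 0 8)]].
have H : all (fun i => all (fun l => all (fun i' => all (fun l' => all (fun j =>
    all (P i l i' l' j) (iota 0 8)) (iota 0 8)) (iota 0 8)) (iota 0 8)) (iota 0 8))
    (iota 0 8) by vm_compute.
move=> hi hl hi' hl' hj hk a1 a2 a3.
move/allP/(_ _ hi)/allP/(_ _ hl)/allP/(_ _ hi')/allP/(_ _ hl')/allP/(_ _ hj)/allP/(_ _ hk): H.
by rewrite /P a1 a2 a3.
Qed.

Lemma ring_pt_center u m : (m < 8)%N -> ring_pt u m != u /\ king u (ring_pt u m).
Proof.
move=> m8; split; last first.
  by rewrite /king /ring_pt /=; move: m8; do 8?[case: m => [|m] //]; move=> _ /=; lia.
rewrite eqE_Z2 -[X in _ == X]addr0 (inj_eq (addrI _)).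
rewrite -[X in _ && (_ == X)]addr0 (inj_eq (addrI _)).
by do 8?[case: m m8 => [|m] m8 //].
Qed.

Lemma king_star p a b N E W y : square p E a N -> square p W b N -> a != b -> king p y ->
  [\/ y \in [:: p; N; a; b; E; W], adj c1 E y, adj c1 W y |
      exists2 F, (king p F && (F \notin [:: p; N; a; b; E; W])) & adj c1 E F /\ adj c1 F y].
Proof.
move=> sq sq' nab kpy.
case: (eqVneq y p) => [->|nyp]; first by constructor 1; rewrite mem_head.
have [i [j [l [[eE eN ea] /and5P[_ hi hj hl c]]]]] := ring_corner sq.
have [i' [j' [l' [[eW eN' eb] /and5P[_ hi' hj' hl' c']]]]] := ring_corner sq'.
have lt8 m : m \in iota 0 8 -> (m < 8)%N by rewrite mem_iota.
have ej : j' = j by apply/eqP; rewrite -(ring_pt_eq p) ?lt8 // -eN -eN'.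
rewrite ej in c'; clear j' ej eN' hj'.
have [k k8 ey] := ring_ptP kpy nyp.
have hk : k \in iota 0 8 by rewrite mem_iota.
have nll : l != l' by apply: contraNneq nab => e; rewrite ea eb e.
have memE m : (m < 8)%N -> (ring_pt p m \in [:: N; a; b; E; W]) = (m \in [:: j; l; l'; i; i']).
  by move=> m8; rewrite !inE eE eN ea eW eb !ring_pt_eq // ?lt8.
case/or4P: (ring_star hi hl hi' hl' hj hk nll c c') => [h|h|h|/hasP[f hf /and3P[nf h1 h2]]].
- by constructor 1; rewrite in_cons ey memE ?h ?orbT.
- by constructor 2; rewrite eE ey; apply: ring_stepP; rewrite ?lt8.
- by constructor 3; rewrite eW ey; apply: ring_stepP; rewrite ?lt8.
constructor 4; exists (ring_pt p f).
  have [h3 ->] := ring_pt_center p (lt8 _ hf); rewrite in_cons negb_or h3 memE ?nf //; exact: lt8.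
by split; rewrite ?eE ?ey; apply: ring_stepP; rewrite ?lt8.
Qed.

Lemma csum_is_edge_head (x y : Z2) q : uniq (x :: y :: q) -> last y q != y ->
  csum (is_edge x y) (x :: y :: q).
Proof.
move=> us nl; have xy : (x == y) = false.
  by apply/negbTE; apply: contraTneq us => ->; rewrite /= mem_head.
rewrite csum_cons /= {1}/is_edge !eqxx /= psum_is_edge0.
  by rewrite /is_edge (negbTE nl) xy andbF.
by move: us; rewrite cons_uniq => /andP[].
Qed.

(** The points [E] and [W] are off [S] by [neighbour_shrinks], and exterior because crossing the
    steps at [p] changes the winding. This first excludes other points of [S] next to [p], then
    interior ones. *)
Lemma star_local S I O p a b N E W : uniq S -> cycle king S -> sides S I O ->
    I N -> sedge S p a -> sedge S p b -> a != b ->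
    square p E a N -> square p W b N -> ~ shrinks S I O ->
  forall y, king p y -> y \in S \/ I y -> y \in [:: p; N; a; b].
Proof.
move=> uS kS SIO IN ea eb nab sq sq' nsh.
have NS : N \notin S by case: SIO => _ _ cov _ _; apply/cov; left.
have nba : b != a by rewrite eq_sym.
have ES : E \notin S.
  by apply/negP => h; apply: nsh; apply: neighbour_shrinks uS kS SIO IN ea eb nab sq sq' h.
have WS : W \notin S.
  by apply/negP => h; apply: nsh; apply: neighbour_shrinks uS kS SIO IN eb ea nba sq' sq h.
have [dpa ca] := square_corners sq; have [dpb cb] := square_corners sq'.
have dneq x y : diag x y -> x != y by case/and3P=> _ n _; apply: contraNneq n => ->.
have [q [uq kq qS lq _]] := star_list uS kS ea eb nab (dneq _ _ dpa) (dneq _ _ dpb).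
have sub : {subset p :: a :: q <= S} by move=> x; rewrite qS.
have jump c r m : square p r m N -> r \notin S -> cycle king c -> {subset c <= S} ->
    winding r c (+) winding N c = csum (is_edge p m) c.
  move=> sqm rS kc cS; have [d cm] := square_corners sqm.
  have rc : r \notin c by apply: contra rS => /cS.
  have Nc : N \notin c by apply: contra NS => /cS.
  by case: cm => -[e1 e2]; have := winding_diag kc d; rewrite e1 e2 => <- //; rewrite addbC.
have lqa : last a q != a by rewrite lq.
have outE c r m : square p r m N -> r \notin S -> cycle king c -> {subset c <= S} ->
    csum (is_edge p m) c -> I r -> False.
  move=> sqm rS kc cS hc Ir; have := jump c r m sqm rS kc cS.
  by rewrite hc (sides_winding_in SIO kc cS Ir IN) addbb.
have cov z : z \notin S -> I z \/ O z by case: SIO => _ _ cov _ _ /cov.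
have OE : O E.
  case: (cov _ ES) => // IE; exfalso.
  exact: outE sq ES kq sub (csum_is_edge_head uq lqa) IE.
have OW : O W.
  case: (cov _ WS) => // IW; exfalso.
  have [q' [uq' kq' qS' lq' _]] := star_list uS kS eb ea nba (dneq _ _ dpb) (dneq _ _ dpa).
  have sub' : {subset p :: b :: q' <= S} by move=> x; rewrite qS'.
  have lqb : last b q' != b by rewrite lq'.
  exact: outE sq' WS kq' sub' (csum_is_edge_head uq' lqb) IW.
have onS y : king p y -> y \in S -> y \in [:: p; a; b].
  move=> kpy yS; rewrite -[_ \in _]negbK; apply/negP; rewrite !inE !negb_or => /and3P[yp ya yb].
  have yq : y \in q by move: yS; rewrite -qS !inE (negbTE yp) (negbTE ya).
  have [q1 [K eq]] : exists q1 K, q = q1 ++ y :: K.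
    by case/splitPr: yq => q1 K; exists q1, K.
  (* This walk uses the step from [p] to [a] but not the one from [p] to [b]. Hence it separates [N]
     from [E] but not from [W], although it has winding 0 around both [E] and [W]. *)
  pose c := p :: a :: rcons q1 y.
  have cS : {subset c <= S}.
    move=> z zc; apply: sub; rewrite eq; move: zc; rewrite !inE mem_rcons mem_cat !inE.
    by case/or4P=> ->; rewrite ?orbT.
  have bK : b \in K.
    move: yb; rewrite -lq eq last_cat /=; case: (K) => [|k K'] /=; first by rewrite eqxx.
    by move=> _; exact: (mem_last k K').
  have uc : uniq c.
    move: uq; rewrite eq -cat_rcons -!cat_cons cat_uniq => /and3P[]//.
  have bc : b \notin c.
    move: uq; rewrite eq -cat_rcons -!cat_cons cat_uniq => /and3P[_ /hasPn h _].
    exact: h bK.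
  have kc : cycle king c.
    move: kq; rewrite eq /= rcons_cat cat_path /= => /and4P[h1 h2 h3 _].
    by rewrite h1 !rcons_path last_rcons h2 h3 king_sym.
  have la : last a (rcons q1 y) != a by rewrite last_rcons.
  have h1 := jump c E a sq ES kc cS; have h2 := jump c W b sq' WS kc cS.
  rewrite (sides_winding_out SIO kc cS OE) (csum_is_edge_head uc la) in h1.
  rewrite (sides_winding_out SIO kc cS OW) h1 csum_cons psum_is_edgeC psum_is_edge0 // in h2.
  move: h2; rewrite /is_edge /= last_rcons (negbTE yb).
  by move: bc; rewrite inE negb_or eq_sym => /andP[/negbTE->]; rewrite andbF.
have Iadj z w : O z -> adj c1 z w -> ~ I w.
  move=> Oz zw Iw; case: SIO => _ _ _ _ na.
  by have := na _ _ Iw Oz; rewrite adj1_sym zw.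
have O_notI z : O z -> ~ I z.
  case: SIO => _ [_ dis] _ _ _ Oz Iz.
  by have : (I `&` O) z by []; rewrite dis.
move=> y kpy [yS|Iy].
  by have := onS _ kpy yS; rewrite !inE => /or3P[]->; rewrite ?orbT.
(* An interior [y] would be [c1]-adjacent to [E], to [W], or to a point [F] that is exterior because
   it is next to [E]. *)
case: (king_star sq sq' nab kpy) => [|/(Iadj _ _ OE)//|/(Iadj _ _ OW)//|].
  rewrite !inE => /or4P[->|->|->|/or3P[->|/eqP yE|/eqP yW]]; rewrite ?orbT //.
    by case: (O_notI _ OE); rewrite -yE.
  by case: (O_notI _ OW); rewrite -yW.
case=> F /andP[kpF nF] [aEF aFy].
have FS : F \notin S.
  apply: contra nF => FS; have := onS _ kpF FS; rewrite !inE => /or3P[]->;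
  by rewrite ?orbT.
case: (cov _ FS) => [/(Iadj _ _ OE aEF)//|OF].
by case: (Iadj _ _ OF aFy).
Qed.

(** * Minimality of the curve and shape of the angle *)

Lemma no_shrink s X O : minimal_bounding_curve s X -> sides s (Int s) O ->
  ~ shrinks s (Int s) O.
Proof.
move=> [[_ _ eX] min] SIO [Z [uZ kZ ZS sz SZ]].
have [sepZ eInt] := sides_separates SZ.
suff /min : bounding_curve Z X by rewrite leqNgt sz.
split=> //.
  by apply/andP; split=> //; apply: sub_cycle kZ => a b; rewrite king_adjeq.
rewrite eInt eX; apply/seteqP; split=> x.
  case=> [xS|]; last by right; left.
  by case: (boolP (x \in Z)) => xZ; [left|right; right; rewrite /= xZ andbT].
by case=> [/ZS|[|/andP[]]]; [left|right|left].
Qed.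

(** An axis-parallel unit step [d] strictly between two orthogonal diagonal steps bisects their
    angle, so their sum is [2 d]. The finitely many positions are enumerated. *)
Lemma sector_arith (u1 u2 v1 v2 d1 d2 : int) (a b : rat) : 0 < a -> 0 < b ->
    `|u1| <= 1 -> `|v1| <= 1 -> `|u1| = `|u2| -> `|v1| = `|v2| ->
    u1 * v1 + u2 * v2 = 0 ->
    d1 = 0 /\ (d2 = 1 \/ d2 = -1) \/ d2 = 0 /\ (d1 = 1 \/ d1 = -1) ->
    d1%:~R = a * u1%:~R + b * v1%:~R -> d2%:~R = a * u2%:~R + b * v2%:~R ->
  [/\ u1 <> 0, v1 <> 0, u1 + v1 = d1 + d1 & u2 + v2 = d2 + d2].
Proof.
move=> a0 b0 u1b v1b eu ev.
have [e2|e2] : u2 = u1 \/ u2 = - u1 by lia.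
all: have [f2|f2] : v2 = v1 \/ v2 = - v1 by lia.
all: have [e1|[e1|e1]] : u1 = 0 \/ u1 = 1 \/ u1 = -1 by lia.
all: have [f1|[f1|f1]] : v1 = 0 \/ v1 = 1 \/ v1 = -1 by lia.
all: subst u2 v2 u1 v1; clear u1b v1b eu ev; move=> orth; try (exfalso; lia); clear orth.
all: case=> -[-> [->|->]] h1 h2; try (exfalso; lra).
all: split; lia.
Qed.

Lemma sector_squares (p q a b : Z2) (al be : rat) : 0 < al -> 0 < be ->
    king p a -> king p b -> `|a.1 - p.1| = `|a.2 - p.2| -> `|b.1 - p.1| = `|b.2 - p.2| ->
    (a.1 - p.1) * (b.1 - p.1) + (a.2 - p.2) * (b.2 - p.2) = 0 ->
    q.1%:~R = p.1%:~R + al * (a.1%:~R - p.1%:~R) + be * (b.1%:~R - p.1%:~R) ->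
    q.2%:~R = p.2%:~R + al * (a.2%:~R - p.2%:~R) + be * (b.2%:~R - p.2%:~R) ->
    adj c1 p q ->
  exists E W, [/\ square p E a q, square p W b q & a != b].
Proof.
move=> al0 be0 /kingE[k1 k2 k3 k4] /kingE[k5 k6 k7 k8] sla slb o e1 e2 /adj1E apq.
have h1 : (q.1 - p.1)%:~R = al * (a.1 - p.1)%:~R + be * (b.1 - p.1)%:~R.
  by rewrite !rmorphB /= e1; ring.
have h2 : (q.2 - p.2)%:~R = al * (a.2 - p.2)%:~R + be * (b.2 - p.2)%:~R.
  by rewrite !rmorphB /= e2; ring.
have d : q.1 - p.1 = 0 /\ (q.2 - p.2 = 1 \/ q.2 - p.2 = -1) \/
         q.2 - p.2 = 0 /\ (q.1 - p.1 = 1 \/ q.1 - p.1 = -1).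
  by clear - apq; lia.
have ua : `|a.1 - p.1| <= 1 by clear - k1 k2; lia.
have ub : `|b.1 - p.1| <= 1 by clear - k5 k6; lia.
have [u0 v0 s1 s2] := sector_arith al0 be0 ua ub sla slb o d h1 h2.
clear - sla slb ua ub d u0 v0 s1 s2.
(* The fourth corners of the unit squares through [p], [a], [q] and through [p], [b], [q]. *)
exists (p.1 + a.1 - q.1, p.2 + a.2 - q.2), (p.1 + b.1 - q.1, p.2 + b.2 - q.2).
split.
- split; first by apply: diagI => /=; lia.
  by case: d => -[e1 e2]; [right|left]; split; apply: Z2_eq => /=; lia.
- split; first by apply: diagI => /=; lia.
  by case: d => -[e1 e2]; [right|left]; split; apply: Z2_eq => /=; lia.
- apply/negP => /eqP eab; rewrite eab in s1 s2 u0 sla; lia.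
Qed.

Lemma thick_squares s E1 E2 p q : uniq s -> cycle king s -> slanted E1 -> slanted E2 ->
    meet_at s E1 E2 p -> orthogonal_at s p -> convex_sector s p (toQ2 q) -> adj c1 p q ->
  exists E W, [/\ square p E (prev s p) q, square p W (next s p) q,
    prev s p != next s p, sedge s p (prev s p) & sedge s p (next s p)].
Proof.
move=> us ks [_ sl1] [_ sl2] [[_ E1s _] _ eE hE] orth [al [be [al0 be0 eq]]] apq.
have [pE1 pE2] : (E1 `&` E2) p by rewrite eE.
have ps : p \in s by exact: E1s.
have ea : sedge s p (prev s p).
  by rewrite /sedge ps mem_prev ps next_prev // eqxx orbT.
have eb : sedge s p (next s p) by rewrite /sedge ps mem_next ps eqxx.
have sla : `|(prev s p).1 - p.1| = `|(prev s p).2 - p.2|.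
  by case: hE => -[h1 h2]; [apply: sl1|apply: sl2].
have slb : `|(next s p).1 - p.1| = `|(next s p).2 - p.2|.
  by case: hE => -[h1 h2]; [apply: sl2|apply: sl1].
have [] := sector_squares al0 be0 (sedgeP ks king_sym ea) (sedgeP ks king_sym eb)
  sla slb orth (f_equal (fun z : Q2 => z.1) eq) (f_equal (fun z : Q2 => z.2) eq) apq.
by move=> E [W [h1 h2 h3]]; exists E, W.
Qed.

(** * Moving a single point *)

Lemma adj_sym k : symmetric (adj k).
Proof.
move=> x y; rewrite /adj eq_sym (distrC x.1) (distrC x.2) [x.1 == _]eq_sym.
by rewrite [x.2 == _]eq_sym.
Qed.

Lemma adjeq_sym k : symmetric (adjeq k).
Proof. by move=> x y; rewrite /adjeq eq_sym adj_sym. Qed.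

(** If [A] missed [p], the map moving only [p], to [t], would be continuous and fix [A]. It is not
    the identity, and it moves [p] by a distance greater than 1. *)
Lemma forced_point k (X A : set Z2) p t : X p -> X t -> ~~ adjeq k p t ->
    (forall y, X y -> adj k p y -> adjeq k t y) ->
    freezing_set k X A \/ cold_set k X A -> A p.
Proof.
move=> Xp Xt npt ht hA; apply: contrapT => nAp.
have ntp : t <> p by move=> e; move: npt; rewrite /adjeq e eqxx.
pose f x := if x == p then t else x.
have fp : f p = t by rewrite /f eqxx.
have fc : kcontinuous k X f.
  split=> [x|x y] Xx; first by rewrite /f; case: ifP.
  move=> Xy axy; rewrite /f; case: (eqVneq x p) axy => [->|_] axy.
    case: (eqVneq y p) axy => [->|_] axy; first by rewrite /adj eqxx in axy.
    exact: ht.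
  case: (eqVneq y p) axy => [->|_] axy; last by rewrite /adjeq axy orbT.
  by rewrite adjeq_sym; apply: ht => //; rewrite adj_sym.
have fA a : A a -> f a = a.
  by move=> Aa; rewrite /f; case: eqP => // e; case: nAp; rewrite -e.
case: hA => [[_ fr]|[_ _ co]]; first by apply: ntp; rewrite -fp; exact: fr.
have [n [[l pl sl] _] n1] := co f fc fA p Xp.
move: pl; rewrite fp; case: l sl => [|z [|z' l]] sl; rewrite -?sl // in n1 *.
  by case=> _ /= e; case: ntp.
by case=> /= /andP[h _] e _; move: npt; rewrite -e h.
Qed.

Theorem proposition5p3
    (X : set Z2) (s : seq Z2) (E1 E2 : set Z2) (p0 : Z2) (A : set Z2) :
  digital_disk X ->
  minimal_bounding_curve s X ->
  slanted E1 ->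
  slanted E2 ->
  right_interior_angle s E1 E2 p0 ->
  (freezing_set c1 X A \/ cold_set c1 X A \/
   freezing_set c2 X A \/ cold_set c2 X A) ->
  slanted_right_thick s p0 ->
  A p0.
Proof.
move=> _ min sl1 sl2 [mt orth _] hA [N [IN sec apN]].
have [[cc sep eX] _] := min.
have /andP[ks us] : cycle king s && uniq s.
  case/andP: cc => ks us; rewrite us andbT.
  by apply: sub_cycle ks => a b; rewrite king_adjeq.
have [O SIO] := separates_sides sep.
have [E [W [sqa sqb nab ea eb]]] := thick_squares us ks sl1 sl2 mt orth sec apN.
set a := prev s p0 in sqa nab ea; set b := next s p0 in sqb nab eb.
have loc := star_local us ks SIO IN ea eb nab sqa sqb (no_shrink min SIO).
have [ps as'] := sedge_mem ea.
have Xs x : x \in s -> X x by rewrite eX; left.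
have Xy y : X y -> king p0 y -> y \in [:: p0; N; a; b].
  by rewrite eX => h k; apply: loc.
have [dpa _] := square_corners sqa; have [dpb _] := square_corners sqb.
have [_ _ _ aaN] := squareE sqa; have [_ _ _ abN] := squareE sqb.
have dneq x y : diag x y -> x != y by case/and3P=> _ n _; apply: contraNneq n => ->.
have hA1 : (freezing_set c1 X A \/ cold_set c1 X A) \/
           (freezing_set c2 X A \/ cold_set c2 X A) by tauto.
case: hA1 => {}hA.
  (* For [c1], [p0] moves to [a]: its only [c1]-neighbour in [X] is [N], which is [c1]-adjacent to
     [a], while [a] is diagonal to [p0]. *)
  apply: (forced_point (Xs _ ps) (Xs _ as') _ _ hA).
    by rewrite /adjeq negb_or dneq //=; apply/negP => /adj1_ndiag; rewrite dpa.
  move=> y /Xy h apy; have := h (adj1_king apy).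
  rewrite !inE ![y == _]eq_sym => /or4P[/eqP e|/eqP e|/eqP e|/eqP e].
  - by move: (adj1_neq apy); rewrite -e eqxx.
  - by rewrite -e /adjeq aaN orbT.
  - by move: (adj1_ndiag apy); rewrite -e dpa.
  - by move: (adj1_ndiag apy); rewrite -e dpb.
(* For [c2], [p0] moves to its mirror image in [N], which is [c2]-adjacent to [N], [a] and [b] but
   not to [p0]. *)
pose T : Z2 := (N.1 + N.1 - p0.1, N.2 + N.2 - p0.2).
have kT y : y \in [:: N; a; b] -> king T y.
  move/adj1E: apN => hN; move/diagE: dpa => ha; move/diagE: dpb => hb.
  move/adj1E: aaN => ha'; move/adj1E: abN => hb'.
  by rewrite !inE => /or3P[]/eqP->; apply/and4P; split; rewrite /T /=; clear - hN ha hb ha' hb'; lia.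
have aNT : adj c1 N T.
  by move/adj1E: apN => hN; apply: adj1I; rewrite /T /=; clear - hN; lia.
(* Being [c1]-adjacent to the interior point [N], the target cannot be exterior. *)
have XT : X T.
  case: (boolP (T \in s)) => [/Xs//|nT].
  case: SIO => _ _ cov _ na; case/cov: nT => [IT|OT]; first by rewrite eX; right.
  by have := na _ _ IN OT; rewrite aNT.
apply: (forced_point (Xs _ ps) XT _ _ hA).
  rewrite king_adjeq; move/adj1E: apN => hN; apply/negP => /kingE[].
  by rewrite /T /=; clear - hN; lia.
move=> y Xy' apy; rewrite king_adjeq; apply: kT.
have kpy : king p0 y by rewrite -king_adjeq /adjeq apy orbT.
have := Xy _ Xy' kpy; rewrite in_cons => /orP[/eqP e|//].
by move: apy; rewrite e /adj eqxx.
Qed.
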